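(* For every $d\ge 1$ there is no set $\Lambda\subseteq\mathbb{C}^d$ that is simultaneously a set of sampling and a set of interpolation for the Bargmann–Fock space $\mathcal{F}^2(\mathbb{C}^d)$.
   Context: $\mathcal{F}^2(\mathbb{C}^d)$ is the Hilbert space of entire functions $F$ on $\mathbb{C}^d$ with $\|F\|_{\mathcal{F}}^2=\int_{\mathbb{C}^d}|F(z)|^2e^{-\pi|z|^2}dz<\infty$. A set $\Lambda\subseteq\mathbb{C}^d$ is a set of sampling if there are constants $0<A\le B$ with $A\|F\|_{\mathcal{F}}^2\le\sum_{\lambda\in\Lambda}|F(\lambda)|^2e^{-\pi|\lambda|^2}\le B\|F\|_{\mathcal{F}}^2$ for all $F\in\mathcal{F}^2$, and a set of interpolation if for every $(c_\lambda)\in\ell^2(\Lambda)$ there exists $F\in\mathcal{F}^2$ with $F(\lambda)e^{-\pi|\lambda|^2/2}=c_\lambda$ for all $\lambda\in\Lambda$. *)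

(* Defs.v *)
From HB Require Import structures.
From mathcomp Require Import all_boot all_order all_algebra.
From mathcomp Require Import all_classical all_reals all_analysis.
From mathcomp Require Import complex.
Set Implicit Arguments. Unset Strict Implicit. Unset Printing Implicit Defensive.
Import Order.TTheory GRing.Theory Num.Theory.
Local Open Scope ring_scope.
Local Open Scope complex_scope.

Definition cabs2 (R : realType) (z : R[i]) : R := complex.Re z ^+ 2 + complex.Im z ^+ 2.
Definition cabs (R : realType) (z : R[i]) : R := Num.sqrt (cabs2 z).

Definition vnorm2 (R : realType) (d : nat) (z : 'rV[R[i]]_d) : R :=
  \sum_(k < d) cabs2 (z 0 k).
Definition vnorm (R : realType) (d : nat) (z : 'rV[R[i]]_d) : R :=
  Num.sqrt (vnorm2 z).

Definition coord_vec (R : realType) (d : nat) (j : 'I_d) (h : R[i]) :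
  'rV[R[i]]_d := \row_(k < d) (if k == j then h else 0).

Definition continuousCd (R : realType) (d : nat) (F : 'rV[R[i]]_d -> R[i]) :=
  forall (z : 'rV[R[i]]_d) (eps : R), 0 < eps ->
    exists2 delta : R, 0 < delta &
      forall w : 'rV[R[i]]_d, vnorm (w - z) < delta -> cabs (F w - F z) < eps.

Definition partial_holo (R : realType) (d : nat) (F : 'rV[R[i]]_d -> R[i])
    (z : 'rV[R[i]]_d) (j : 'I_d) :=
  exists L : R[i], forall eps : R, 0 < eps ->
    exists2 delta : R, 0 < delta &
      forall h : R[i], h != 0 -> cabs h < delta ->
        cabs ((F (z + coord_vec j h) - F z) / h - L) < eps.

(* entire function on C^d: continuous and holomorphic in each variable
   separately at every point (Osgood's definition of holomorphy) *)
Definition entire (R : realType) (d : nat) (F : 'rV[R[i]]_d -> R[i]) :=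
  continuousCd F /\ forall (z : 'rV[R[i]]_d) (j : 'I_d), partial_holo F z j.

Definition to_Cd (R : realType) (d : nat) (s : seq R) : 'rV[R[i]]_d :=
  \row_(k < d) (nth 0 s (2 * k)%N +i* nth 0 s (2 * k + 1)%N).

Fixpoint iter_int (R : realType) (n : nat) (f : seq R -> \bar R) : \bar R :=
  match n with
  | O => f [::]
  | n'.+1 => (\int[@lebesgue_measure R]_x iter_int n' (fun s => f (x :: s)))%E
  end.

(* Lebesgue integral over C^d = R^{2d} of a nonnegative function
   (as an iterated integral; equal to the product-measure integral by Tonelli) *)
Definition integral_Cd (R : realType) (d : nat) (g : 'rV[R[i]]_d -> \bar R) :
  \bar R := iter_int (2 * d) (fun s => g (to_Cd d s)).

Definition fock_norm2 (R : realType) (d : nat) (F : 'rV[R[i]]_d -> R[i]) :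
  \bar R := integral_Cd (fun z => (cabs2 (F z) * expR (- pi * vnorm2 z))%:E).

Definition in_fock (R : realType) (d : nat) (F : 'rV[R[i]]_d -> R[i]) :=
  entire F /\ (fock_norm2 F < +oo)%E.

Definition sample_sum (R : realType) (d : nat) (L : set 'rV[R[i]]_d)
    (F : 'rV[R[i]]_d -> R[i]) : \bar R :=
  \esum_(l in L) (cabs2 (F l) * expR (- pi * vnorm2 l))%:E.

Definition sampling_set (R : realType) (d : nat) (L : set 'rV[R[i]]_d) :=
  exists A B : R, [/\ 0 < A, A <= B &
    forall F, in_fock F ->
      (A%:E * fock_norm2 F <= sample_sum L F)%E /\
      (sample_sum L F <= B%:E * fock_norm2 F)%E].

(* (c_lambda) in l^2(Lambda), represented by c : C^d -> C restricted to Lambda *)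
Definition interpolation_set (R : realType) (d : nat) (L : set 'rV[R[i]]_d) :=
  forall c : 'rV[R[i]]_d -> R[i],
    (\esum_(l in L) (cabs2 (c l))%:E < +oo)%E ->
    exists F, in_fock F /\
      forall l, L l -> F l * (expR (- pi * vnorm2 l / 2))%:C = c l.

(* Main.v *)
Require Import Defs.
From HB Require Import structures.
From mathcomp Require Import all_boot all_order all_algebra.
From mathcomp Require Import all_classical all_reals all_analysis.
From mathcomp Require Import finmap measurable_realfun complex ring lra.
Set Implicit Arguments. Unset Strict Implicit. Unset Printing Implicit Defensive.
Import Order.TTheory GRing.Theory Num.Theory.
Import numFieldNormedType.Exports.
Local Open Scope classical_set_scope.
Local Open Scope ring_scope.
Local Open Scope complex_scope.

(* Suppose L is both sampling and interpolating, and let k_w be the normalized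
   reproducing kernels. Sampling gives a Bessel bound, hence uniform Gaussian
   off-diagonal decay of the Gram matrix Gam = (<k_m, k_l>) over L; interpolation gives
   Gam >= A. Because of the decay, Gam stays coercive on l^2 with the weight
   1 + eps |l_j - l0_j| for small eps (Combes-Thomas), so Gam c = e_{l0} can be solved up
   to small weighted errors by finitely supported c. The functions G = sum c_m k_m then
   converge to the interpolant F of e_{l0}, while (z_j - l0_j) G has samples tending to 0
   and so tends to 0 by the sampling inequality. Thus F vanishes off the hyperplane
   z_j = l0_j, hence everywhere, contradicting F(l0) <> 0.
   The only fact needed about a general entire F is the sharp bound
   |F(w)|^2 e^{-pi |w|^2} <= |F|^2, obtained from Goursat's theorem by averaging over
   rotations; the reproducing formula follows from it by a first variation at k_w. *)

(** * Complex differentiability *)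

(** Two obstacles shape the argument. Multiplication by z_j does not preserve the Fock space, so the
    interpolant cannot simply be multiplied by z_j - l0_j. The product is formed only for finite
    kernel combinations, whose Gaussian decay absorbs any polynomial, and the linear weight is what
    controls the samples of the product in the limit. A weight in a single coordinate suffices,
    since a continuous function vanishing off a hyperplane vanishes. The other obstacle is that the
    norm is an iterated integral of nonnegative functions, with no inner product at hand. Scalar
    products therefore occur only as cross terms in identities between norms, written as equalities
    of nonnegative combinations. Weighted l^2 norms over L are replaced by bounds valid on every
    finite subset, and limits by estimates with an arbitrary [delta]. Measurability through the 2d
    nested integrations is carried by lower semicontinuity. *)

Section ComplexModulus.
Variable R : realType.
Implicit Types (z w : R[i]) (r : R).

Lemma cabsE z : cabs z = ComplexField.Normc.normc z.
Proof. by case: z => a b. Qed.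

Lemma cabs2_ge0 z : 0 <= cabs2 z.
Proof. by rewrite addr_ge0 ?sqr_ge0. Qed.

Lemma cabs_ge0 z : 0 <= cabs z.
Proof. exact: sqrtr_ge0. Qed.

Lemma sqr_cabs z : cabs z ^+ 2 = cabs2 z.
Proof. by rewrite sqr_sqrtr ?cabs2_ge0. Qed.

Lemma cabs0 : cabs (0 : R[i]) = 0.
Proof. by rewrite cabsE ComplexField.Normc.normc0. Qed.

Lemma cabsM z w : cabs (z * w) = cabs z * cabs w.
Proof. by rewrite !cabsE ComplexField.Normc.normcM. Qed.

Lemma cabsD z w : cabs (z + w) <= cabs z + cabs w.
Proof. by rewrite !cabsE; exact: le_normcD. Qed.

Lemma cabsN z : cabs (- z) = cabs z.
Proof. by rewrite !cabsE normcN. Qed.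

Lemma cabsBC z w : cabs (z - w) = cabs (w - z).
Proof. by rewrite -cabsN opprB. Qed.

Lemma cabs2M z w : cabs2 (z * w) = cabs2 z * cabs2 w.
Proof. by rewrite -!sqr_cabs cabsM exprMn. Qed.

Lemma cabs2N z : cabs2 (- z) = cabs2 z.
Proof. by rewrite -!sqr_cabs cabsN. Qed.

Lemma cabs2_0 : cabs2 (0 : R[i]) = 0.
Proof. by rewrite -sqr_cabs cabs0 expr0n. Qed.

Lemma cabs_eq0 z : (cabs z == 0) = (z == 0).
Proof.
apply/eqP/eqP => [|->]; last exact: cabs0.
by rewrite cabsE; exact: ComplexField.Normc.eq0_normc.
Qed.

Lemma cabs_gt0 z : (0 < cabs z) = (z != 0).
Proof. by rewrite lt0r cabs_ge0 andbT cabs_eq0. Qed.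

Lemma cabs_real r : cabs r%:C = `|r|.
Proof. by rewrite /cabs /cabs2 /= expr0n addr0 sqrtr_sqr. Qed.

Lemma cabs2_real r : cabs2 r%:C = r ^+ 2.
Proof. by rewrite /cabs2 /= expr0n addr0. Qed.

Lemma cabs1 : cabs (1 : R[i]) = 1.
Proof. by rewrite cabs_real normr1. Qed.

Lemma cabsV z : cabs z^-1 = (cabs z)^-1.
Proof. by rewrite !cabsE ComplexField.Normc.normcV. Qed.

Lemma normRe_cabs z : `|complex.Re z| <= cabs z.
Proof. by rewrite -sqrtr_sqr ler_wsqrtr// /cabs2 lerDl sqr_ge0. Qed.

Lemma normIm_cabs z : `|complex.Im z| <= cabs z.
Proof. by rewrite -sqrtr_sqr ler_wsqrtr// /cabs2 lerDr sqr_ge0. Qed.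

Lemma cabs_ReIm z : cabs z <= `|complex.Re z| + `|complex.Im z|.
Proof.
rewrite -(@ler_pXn2r _ 2)// ?nnegrE ?addr_ge0 ?cabs_ge0//.
rewrite sqr_cabs /cabs2 sqrrD !real_normK ?num_real// [leRHS]addrAC lerDl.
by rewrite mulrn_wge0// mulr_ge0.
Qed.

Lemma cabs2D_le z w : cabs2 (z + w) <= 2 * cabs2 z + 2 * cabs2 w.
Proof.
case: z w => [a b] [c d]; rewrite /cabs2 /=.
have := sqr_ge0 (a - c); have := sqr_ge0 (b - d).
rewrite !sqrrD !sqrrN !mulrN !mulr2n; lra.
Qed.

Lemma ReD z w : complex.Re (z + w) = complex.Re z + complex.Re w.
Proof. by case: z w => [a b] [c d]. Qed.

Lemma ImD z w : complex.Im (z + w) = complex.Im z + complex.Im w.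
Proof. by case: z w => [a b] [c d]. Qed.

Lemma ReN z : complex.Re (- z) = - complex.Re z.
Proof. by case: z. Qed.

Lemma ImN z : complex.Im (- z) = - complex.Im z.
Proof. by case: z. Qed.

Lemma ReM z w : complex.Re (z * w) =
  complex.Re z * complex.Re w - complex.Im z * complex.Im w.
Proof. by case: z w => [a b] [c d]. Qed.

Lemma ImM z w : complex.Im (z * w) =
  complex.Re z * complex.Im w + complex.Im z * complex.Re w.
Proof. by case: z w => [a b] [c d]. Qed.

Lemma Re_conj z : complex.Re (conjc z) = complex.Re z.
Proof. by case: z. Qed.

Lemma Im_conj z : complex.Im (conjc z) = - complex.Im z.
Proof. by case: z. Qed.

Lemma cabs_conj z : cabs (conjc z) = cabs z.
Proof. by rewrite /cabs /cabs2 Re_conj Im_conj sqrrN. Qed.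

End ComplexModulus.

(** Converts a derivative given as a limit of quotients into an increment estimate, the form in
    which real and complex derivatives are combined below. *)
Lemma derive_linear_approx (R : realType) (f : R -> R) (x df : R) :
  is_derive x 1 f df -> forall e : R, 0 < e -> exists2 delta : R, 0 < delta &
    forall h : R, `|h| < delta -> `|f (x + h) - f x - df * h| <= e * `|h|.
Proof.
move=> fdf e e0; case: (fdf) => dfx fE.
have : h^-1 *: (f (h *: (1 : R) + x) - f x) @[h --> (0 : R)^'] --> df.
  by rewrite -fE; exact: dfx.
move=> /cvgrPdist_le /(_ _ e0); rewrite near_withinE => -[d /= d0 Hd].
exists d => // h hd; have [->|h0] := eqVneq h 0.
  by rewrite addr0 subrr mulr0 subr0 normr0 mulr0.
have := Hd h; rewrite /ball_/= sub0r normrN => /(_ hd h0).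
rewrite /GRing.scale /= mulr1 [h + x]addrC => H.
rewrite -[X in `|X|](_ : (h^-1 * (f (x + h) - f x) - df) * h = _); last first.
  by rewrite mulrBl mulrAC mulVf// mul1r.
by rewrite normrM ler_wpM2r// distrC.
Qed.

Section ComplexExponential.
Variable R : realType.
Implicit Types z w : R[i].

Definition cexp z : R[i] :=
  (expR (complex.Re z) * cos (complex.Im z)) +i*
  (expR (complex.Re z) * sin (complex.Im z)).

Lemma cexp0 : cexp 0 = 1.
Proof. by rewrite /cexp /= expR0 cos0 sin0 mulr1 mulr0. Qed.

Lemma cexpD z w : cexp (z + w) = cexp z * cexp w.
Proof.
apply/eqP; rewrite eq_complex ReM ImM /= ReD ImD expRD cosD sinD.
by apply/andP; split; apply/eqP; ring.
Qed.

Lemma cabs2_cexp z : cabs2 (cexp z) = expR (2 * complex.Re z).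
Proof.
by rewrite /cabs2 /= !exprMn -mulrDr cos2Dsin2 mulr1 -expRM_natl.
Qed.

Lemma cabs_cexp z : cabs (cexp z) = expR (complex.Re z).
Proof. by rewrite /cabs cabs2_cexp mulrC expRM_natr sqrtr_sqr gtr0_norm ?expR_gt0. Qed.

Lemma cexp_conj z : cexp (conjc z) = (conjc (cexp z)).
Proof. by rewrite /cexp Re_conj Im_conj cosN sinN; case: z => a b /=; rewrite mulrN. Qed.

Lemma cexp_real (r : R) : cexp r%:C = (expR r)%:C.
Proof. by rewrite /cexp /= cos0 sin0 mulr1 mulr0. Qed.

End ComplexExponential.

Section ComplexDerivative.
Variable R : realType.
Implicit Types (f g : R[i] -> R[i]) (z L M : R[i]).

(** Stated on increments rather than quotients: h = 0 is allowed, so composition never has to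
    separate the case of a vanishing inner increment. *)
Definition cderiv f z L := forall eps : R, 0 < eps ->
  exists2 delta : R, 0 < delta & forall h, cabs h < delta ->
    cabs (f (z + h) - f z - L * h) <= eps * cabs h.

Definition cdiff f := forall z, exists L, cderiv f z L.

Lemma cderiv_lip f z L : cderiv f z L -> exists2 delta : R, 0 < delta &
  forall h, cabs h < delta -> cabs (f (z + h) - f z) <= (1 + cabs L) * cabs h.
Proof.
move=> /(_ 1 ltr01)[d d0 H]; exists d => // h /H hh.
have -> : f (z + h) - f z = (f (z + h) - f z - L * h) + L * h by ring.
by rewrite (le_trans (cabsD _ _))// cabsM mulrDl lerD2r.
Qed.

Lemma cderiv_cst z (c : R[i]) : cderiv (fun=> c) z 0.
Proof.
move=> e e0; exists 1 => // h _.
by rewrite subrr mul0r subrr cabs0 mulr_ge0 ?cabs_ge0 ?ltW.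
Qed.

Lemma cderivD f g z L M : cderiv f z L -> cderiv g z M ->
  cderiv (fun t => f t + g t) z (L + M).
Proof.
move=> hf hg e e0; have e20 : 0 < e / 2 by rewrite divr_gt0.
have [d1 d10 H1] := hf _ e20; have [d2 d20 H2] := hg _ e20.
exists (Num.min d1 d2); first by rewrite lt_min d10.
move=> h; rewrite lt_min => /andP[/H1 h1 /H2 h2].
have -> : f (z + h) + g (z + h) - (f z + g z) - (L + M) * h =
  (f (z + h) - f z - L * h) + (g (z + h) - g z - M * h) by ring.
by rewrite (le_trans (cabsD _ _))//; lra.
Qed.

Lemma cderiv_comp f g z L M : cderiv g z M -> cderiv f (g z) L ->
  cderiv (f \o g) z (L * M).
Proof.
move=> hg hf e e0; have [d0 d00 H0] := cderiv_lip hg.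
have lM : 0 < 1 + cabs M by rewrite ltr_pwDl ?cabs_ge0.
have lL : 0 < 1 + cabs L by rewrite ltr_pwDl ?cabs_ge0.
(* The increment of g is at most (1 + |M|) |h|, so this tolerance costs e/2 |h|; the tolerance for g
   is divided by 1 + |L| because its error gets multiplied by L. *)
have [d1 d10 H1] : exists2 d : R, 0 < d & forall h, cabs h < d ->
   cabs (f (g z + h) - f (g z) - L * h) <= e / 2 / (1 + cabs M) * cabs h.
  by apply: hf; rewrite !divr_gt0.
have [d2 d20 H2] : exists2 d : R, 0 < d & forall h, cabs h < d ->
   cabs (g (z + h) - g z - M * h) <= e / 2 / (1 + cabs L) * cabs h.
  by apply: hg; rewrite !divr_gt0.
exists (Num.min d0 (Num.min d2 (d1 / (1 + cabs M)))).
  by rewrite !lt_min d00 d20 divr_gt0.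
move=> h; rewrite !lt_min => /and3P[/H0 h0 /H2 h2 h1] /=.
set k := g (z + h) - g z in h0 h2.
have gk : g (z + h) = g z + k by rewrite /k; ring.
have kd : cabs k < d1.
  by rewrite (le_lt_trans h0)// mulrC -ltr_pdivlMr.
have h3 := H1 _ kd; rewrite gk.
have -> : f (g z + k) - f (g z) - L * M * h =
  (f (g z + k) - f (g z) - L * k) + L * (k - M * h) by ring.
rewrite (le_trans (cabsD _ _))// cabsM.
have a1 : e / 2 / (1 + cabs M) * cabs k <= e / 2 * cabs h.
  by rewrite -mulrA ler_pM2l ?divr_gt0// mulrC ler_pdivrMr// mulrC.
have a2 : cabs L * (e / 2 / (1 + cabs L) * cabs h) <= e / 2 * cabs h.
  rewrite mulrA ler_wpM2r ?cabs_ge0//.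
  have -> : cabs L * (e / 2 / (1 + cabs L)) = e / 2 * (cabs L / (1 + cabs L)) by ring.
  by rewrite ger_pMr ?divr_gt0// ler_pdivrMr// mul1r lerDr.
have a3 : cabs L * cabs (k - M * h) <= e / 2 * cabs h.
  by rewrite (le_trans _ a2)// ler_wpM2l ?cabs_ge0.
lra.
Qed.

Lemma cderiv_lin (a b : R[i]) z : cderiv (fun t => a * t + b) z a.
Proof.
move=> e e0; exists 1 => // h _.
have -> : a * (z + h) + b - (a * z + b) - a * h = 0 by ring.
by rewrite cabs0 mulr_ge0 ?cabs_ge0 ?ltW.
Qed.

Lemma cderiv_sqr z : cderiv (fun t => t * t) z (2 * z).
Proof.
move=> e e0; exists e => // h he.
have -> : (z + h) * (z + h) - z * z - 2 * z * h = h * h by ring.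
by rewrite cabsM ler_wpM2r ?cabs_ge0 ?ltW.
Qed.

(* Polarization: the product rule follows from those for sums and squares. *)
Lemma cdiffM f g : cdiff f -> cdiff g -> cdiff (fun t => f t * g t).
Proof.
move=> hf hg z; have [L hL] := hf z; have [M hM] := hg z.
pose u t := 2^-1 * f t + 2^-1 * g t; pose v t := 2^-1 * f t + (- 2^-1) * g t.
have lin (c : R[i]) k K : cderiv k z K -> cderiv (fun t => c * k t) z (c * K).
  move=> hk; have := cderiv_comp hk (cderiv_lin c 0 (k z)).
  by under eq_fun do rewrite /= addr0.
have hu := cderiv_comp (cderivD (lin 2^-1 _ _ hL) (lin 2^-1 _ _ hM)) (cderiv_sqr (u z)).
have hv := cderiv_comp (cderivD (lin 2^-1 _ _ hL) (lin (- 2^-1) _ _ hM)) (cderiv_sqr (v z)).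
eexists; have := cderivD hu (lin (-1) _ _ hv).
set F := (fun t => _); have -> : F = (fun t => f t * g t); last exact: id.
by apply/funext => t; rewrite /F /=; field.
Qed.

Lemma cdiff_comp f g : cdiff f -> cdiff g -> cdiff (f \o g).
Proof.
move=> hf hg z; have [M hM] := hg z; have [L hL] := hf (g z).
by exists (L * M); exact: cderiv_comp.
Qed.

Lemma cdiff_cst (c : R[i]) : cdiff (fun=> c).
Proof. by move=> z; exists 0; exact: cderiv_cst. Qed.

Lemma cdiff_lin (a b : R[i]) : cdiff (fun t => a * t + b).
Proof. by move=> z; exists a; exact: cderiv_lin. Qed.

Lemma cderiv_cexp0 : cderiv (@cexp R) 0 1.
Proof.
(* The real part of the error will cost 3 units of e/8 |h| and the imaginary part 5, which add up to
   e |h|. The cap at 1 gives |1 + a| <= 2 and |sin b| <= 2 |h|. *)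
move=> e e0; pose e1 := Num.min (e / 8) 1.
have e10 : 0 < e1 by rewrite lt_min ltr01 divr_gt0.
have e1e : e1 <= e / 8 by rewrite ge_min lexx.
have e11 : e1 <= 1 by rewrite ge_min lexx orbT.
clearbody e1.
have [d1 d10 H1] := derive_linear_approx (is_derive_expR (0 : R)) e10.
have [d2 d20 H2] := derive_linear_approx (is_derive_cos (0 : R)) e10.
have [d3 d30 H3] := derive_linear_approx (is_derive_sin (0 : R)) e10.
exists (Num.min (Num.min d1 e1) (Num.min d2 d3)).
  by rewrite !lt_min d10 d20 d30 e10.
move=> h; rewrite !lt_min => /andP[/andP[h1 he] /andP[h2 h3]].
rewrite add0r cexp0 mul1r (le_trans (cabs_ReIm _))//.
rewrite !ReD !ImD !ReN !ImN /= oppr0 addr0.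
have ha := normRe_cabs h; have hb := normIm_cabs h.
set a := complex.Re h in ha *; set b := complex.Im h in hb *.
move: H1 => /(_ a (le_lt_trans ha h1)); move: H2 => /(_ b (le_lt_trans hb h2)).
move: H3 => /(_ b (le_lt_trans hb h3)).
rewrite !add0r expR0 cos0 sin0 oppr0 mul0r !mul1r !subr0 !addr0 => h3' h2' h1'.
set H := cabs h in ha hb he *; have H0 : 0 <= H by exact: cabs_ge0.
have lh : forall x : R, `|x| <= H -> e1 * `|x| <= e / 8 * H.
  by move=> x hx; rewrite ler_pM// ltW.
have q1 := le_trans h1' (lh _ ha); have q2 := le_trans h2' (lh _ hb).
have q3 := le_trans h3' (lh _ hb).
have r1 : `|(expR a * cos b - 1 - a)| <= 3 * (e / 8 * H).
  have -> : expR a * cos b - 1 - a = (expR a - 1 - a) * cos b + (cos b - 1) * (1 + a) by ring.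
  rewrite (le_trans (ler_normD _ _))// !normrM.
  have c1 : `|cos b| <= 1 by rewrite ler_norml cos_geN1 cos_le1.
  have c2 : `|1 + a| <= 2 by rewrite (le_trans (ler_normD _ _))// normr1; lra.
  have := ler_pM (normr_ge0 _) (normr_ge0 _) q1 c1.
  have := ler_pM (normr_ge0 _) (normr_ge0 _) q2 c2.
  lra.
have r2 : `|(expR a * sin b - b)| <= 5 * (e / 8 * H).
  have -> : expR a * sin b - b = (expR a - 1) * sin b + (sin b - b) by ring.
  rewrite (le_trans (ler_normD _ _))// !normrM.
  have c1 : `|expR a - 1| <= 2 * (e / 8).
    have -> : expR a - 1 = (expR a - 1 - a) + a by ring.
    rewrite (le_trans (ler_normD _ _))//.
    have : e1 * `|a| <= e1 * 1 by rewrite (ler_pM2l e10) (le_trans ha)// ltW// (lt_le_trans he).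
    lra.
  have c2 : `|sin b| <= 2 * H.
    have -> : sin b = (sin b - b) + b by ring.
    rewrite (le_trans (ler_normD _ _))//.
    have : e1 * `|b| <= 1 * H by rewrite ler_pM// ltW.
    lra.
  have := ler_pM (normr_ge0 _) (normr_ge0 _) c1 c2.
  have -> : 2 * (e / 8) * (2 * H) = 4 * (e / 8 * H) by ring.
  lra.
have -> : e * H = 8 * (e / 8 * H) by field.
lra.
Qed.

(** The addition law exp t = exp z exp(t - z) reduces every point to the derivative at 0. *)
Lemma cdiff_cexp : cdiff (@cexp R).
Proof.
move=> z; exists (cexp z * 1).
have h1 : cderiv (fun t => 1 * t + - z) z 1 by exact: cderiv_lin.
have h2 : cderiv (@cexp R) (1 * z + - z) 1 by rewrite mul1r subrr; exact: cderiv_cexp0.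
have := cderiv_comp (cderiv_comp h1 h2) (cderiv_lin (cexp z) 0 _).
rewrite !mulr1; set F := (_ \o _); suff -> : F = @cexp R by [].
by apply/funext => t; rewrite /F /= addr0 -cexpD mul1r addrC subrK.
Qed.

End ComplexDerivative.

(** * Iterated integrals of lower semicontinuous functions *)

Section LowerSemicontinuousIntegrals.
Variable R : realType.
Local Notation mu := (@lebesgue_measure R).
Implicit Types (s pre : seq R).

Lemma limn_einf_le_cst (u : (\bar R)^nat) (a : \bar R) :
  (forall k, u k <= a)%E -> (limn_einf u <= a)%E.
Proof.
move=> ua; rewrite limn_einf_lim; apply: lime_le; first exact: is_cvg_einfs.
apply: nearW => n; apply: ge_ereal_inf; exists (u n) => //.
by exists n => /=.
Qed.

Lemma le_limn_einf (u v : (\bar R)^nat) :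
  (forall k, u k <= v k)%E -> (limn_einf u <= limn_einf v)%E.
Proof.
move=> uv; rewrite !limn_einf_lim; apply: lee_lim; try exact: is_cvg_einfs.
apply: nearW => n; apply: le_ereal_inf_tmp => _ [k /= nk <-].
by apply: ge_ereal_inf; exists (u k) => //; exists k.
Qed.

(** Sequential lower semicontinuity makes each set {F > a} open; it is then the countable union of
    the boxes with rational centre and radius 1/(n+1) that it contains, and each box is a measurable
    rectangle. *)
Lemma measurable_lsc2 (F : R -> R -> \bar R) :
  (forall (x y : R^nat) (a b : R), x @ \oo --> a -> y @ \oo --> b ->
    (F a b <= limn_einf (fun k => F (x k) (y k)))%E) ->
  measurable_fun [set: R * R] (fun z => F z.1 z.2).
Proof.
move=> Flsc; apply: (measurability _ (ErealGenOInfty.measurableE R)).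
move=> /= _ [_ [a ->]] <-; rewrite preimage_itvoy setTI.
set U := [set z | _].
pose box (i : rat * rat * nat) : set (R * R) :=
  [set z | `|z.1 - ratr i.1.1| < i.2.+1%:R^-1 /\ `|z.2 - ratr i.1.2| < i.2.+1%:R^-1].
have -> : U = \bigcup_(i in [set i | box i `<=` U]) box i.
  apply/seteqP; split => [[x y] Uxy|z [i /= iU iz]]; last exact: iU.
  (* The radius is doubled because the box is centred at a rational point within 1/(n+1) of (x, y),
     not at (x, y) itself. *)
  have [n Hn] : exists n : nat, forall x' y' : R, `|x' - x| < 2 * n.+1%:R^-1 ->
      `|y' - y| < 2 * n.+1%:R^-1 -> U (x', y').
    apply: contrapT => H.
    have /choice[xy Hxy] : forall n : nat, exists z : R * R,
        [/\ `|z.1 - x| < 2 * n.+1%:R^-1, `|z.2 - y| < 2 * n.+1%:R^-1 & ~ U z].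
      move=> n; apply: contrapT => Hn; apply: H; exists n => x' y' xx' yy'.
      by apply: contrapT => Uz; apply: Hn; exists (x', y').
    have lim0 : (2 * n.+1%:R^-1 : R) @[n --> \oo] --> (0 : R).
      rewrite -[X in _ --> X](mulr0 2); apply: cvgM; first exact: cvg_cst.
      exact: cvg_harmonic.
    have cx (c : R) (u : R^nat) : (forall n, `|u n - c| < 2 * n.+1%:R^-1) -> u @ \oo --> c.
      move=> uc; apply/cvgrPdist_lt => e e0.
      move/cvgrPdist_lt : lim0 => /(_ _ e0); apply: filterS => n /=.
      rewrite sub0r normrN ger0_norm ?mulr_ge0// => ne; rewrite distrC.
      exact: lt_trans ne.
    have h1 : (fun n => (xy n).1) @ \oo --> x by apply: cx => n; case: (Hxy n).
    have h2 : (fun n => (xy n).2) @ \oo --> y by apply: cx => n; case: (Hxy n).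
    have := Flsc _ _ _ _ h1 h2; apply/negP; rewrite -ltNge.
    apply: le_lt_trans Uxy; apply: limn_einf_le_cst => k.
    by case: (Hxy k) => _ _ /negP; rewrite -leNgt.
  have n0 : (0 : R) < n.+1%:R^-1 by rewrite invr_gt0.
  pose e : R := n.+1%:R^-1.
  have {}Hn (x' y' : R) : `|x' - x| < 2 * e -> `|y' - y| < 2 * e -> U (x', y') by exact: Hn.
  have {}n0 : 0 < e by [].
  have approx (c : R) : exists p : rat, `|c - ratr p| < e.
    have /rat_in_itvoo[p] : c - e < c + e by move: n0; clear; clearbody e => n0; lra.
    rewrite in_itv /= => /andP[p1 p2]; exists p.
    by rewrite ltr_norml; clearbody e; apply/andP; split; lra.
  have [p hp] := approx x; have [q hq] := approx y.
  exists (p, q, n) => //= z [/=]; rewrite -/e => zp zq; clearbody e.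
  rewrite [z]surjective_pairing; apply: Hn.
    have -> : z.1 - x = (z.1 - ratr p) - (x - ratr p) by ring.
    rewrite (le_lt_trans (ler_normB _ _))//; lra.
  have -> : z.2 - y = (z.2 - ratr q) - (y - ratr q) by ring.
  rewrite (le_lt_trans (ler_normB _ _))//; lra.
rewrite bigcup_mkcond; apply: countable_bigcupT_measurable => // i.
case: ifP => // _.
have -> : box i = [set x | `|x - ratr i.1.1| < i.2.+1%:R^-1] `*`
                  [set y | `|y - ratr i.1.2| < i.2.+1%:R^-1] by [].
have mb (c e : R) : measurable [set x : R | `|x - c| < e].
  have -> : [set x : R | `|x - c| < e] = `]c - e, c + e[%classic.
    by apply/seteqP; split => x /=; rewrite in_itv /= ltr_distl.
  exact: measurable_itv.
exact: measurableX.
Qed.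

Lemma measurable_lsc1 (f : R -> \bar R) :
  (forall (x : R^nat) (a : R), x @ \oo --> a ->
    (f a <= limn_einf (f \o x))%E) -> measurable_fun [set: R] f.
Proof.
move=> flsc.
have h : measurable_fun [set: R * R] (fun z : R * R => f z.1).
  by apply: (@measurable_lsc2 (fun x _ => f x)) => x y a b xa _; exact: flsc.
apply: (measurableT_comp h (@measurable_pair2 _ _ R R (0:R))).
Qed.

(** The integral of a nonnegative function is a supremum over simple functions below it, so
    monotonicity holds whether or not the inner iterated integrals are measurable. *)
Lemma ge0_le_integral_nonmeas (f g : R -> \bar R) :
  (forall x, 0 <= f x)%E -> (forall x, f x <= g x)%E ->
  (\int[mu]_x f x <= \int[mu]_x g x)%E.
Proof.
move=> f0 fg; have g0 x : (0 <= g x)%E by rewrite (le_trans (f0 x)).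
rewrite !ge0_integralTE//; apply: ereal_sup_le => _ [h hf <-].
by exists h => // x; exact: le_trans (hf x) (fg x).
Qed.

Lemma swap_lsc2 (F : R -> R -> \bar R) : (forall x y, 0 <= F x y)%E ->
  (forall (x y : R^nat) (a b : R), x @ \oo --> a -> y @ \oo --> b ->
    (F a b <= limn_einf (fun k => F (x k) (y k)))%E) ->
  (\int[mu]_x \int[mu]_y F x y = \int[mu]_y \int[mu]_x F x y)%E.
Proof.
move=> F0 /measurable_lsc2 mF.
exact: (@fubini_tonelli _ _ _ _ _ mu mu (fun z => F z.1 z.2) mF).
Qed.

(* Lower semicontinuity on vectors of a fixed length is the regularity that
   partial integration of a nonnegative function preserves (Fatou). *)
Definition lscn (p : nat) (f : seq R -> \bar R) :=
  forall (u : nat -> seq R) s, (forall k, size (u k) = p) -> size s = p ->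
    (forall i, (fun k => nth 0 (u k) i) @ \oo --> nth 0 s i) ->
    (f s <= limn_einf (f \o u))%E.

Lemma cvg_nth_rcons p (u : nat -> seq R) s (x : R^nat) (a : R) :
  (forall k, size (u k) = p) -> size s = p ->
  (forall i, (fun k => nth 0 (u k) i) @ \oo --> nth 0 s i) -> x @ \oo --> a ->
  forall i, (fun k => nth 0 (rcons (u k) (x k)) i) @ \oo --> nth 0 (rcons s a) i.
Proof.
move=> su ss us xa i; rewrite nth_rcons ss.
have -> : (fun k => nth 0 (rcons (u k) (x k)) i) = (fun k =>
    if (i < p)%N then nth 0 (u k) i else if i == p then x k else 0).
  by apply/funext => k; rewrite nth_rcons su.
by case: ifP => // _; case: ifP => // _; exact: cvg_cst.
Qed.

Lemma lscn_measurable p f pre : lscn p.+1 f -> size pre = p ->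
  measurable_fun [set: R] (fun x => f (rcons pre x)).
Proof.
move=> lf sp; apply: measurable_lsc1 => x a xa.
apply: (lf (fun k => rcons pre (x k))); rewrite ?size_rcons ?sp//.
  by move=> k; rewrite size_rcons sp.
by apply: (@cvg_nth_rcons p (fun=> pre)) => // i; exact: cvg_cst.
Qed.

Lemma lscn_integral p f : (forall s, 0 <= f s)%E -> lscn p.+1 f ->
  lscn p (fun pre => \int[mu]_x f (rcons pre x))%E.
Proof.
move=> f0 lf u s su ss us /=.
apply: (@le_trans _ _ (\int[mu]_x limn_einf (fun k => f (rcons (u k) x)))%E).
  apply: ge0_le_integral_nonmeas => [//|x].
  apply: (lf (fun k => rcons (u k) x)); rewrite ?size_rcons ?ss//.
    by move=> k; rewrite size_rcons su.
  by apply: (@cvg_nth_rcons p _ _ (fun=> x)) => //; exact: cvg_cst.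
apply: (@fatou _ _ _ mu setT measurableT (fun k x => f (rcons (u k) x))) => //.
by move=> k; apply: lscn_measurable lf _.
Qed.

(** The variables already fixed are kept as a prefix [pre]. One function f on the whole list then
    serves at every depth, and its semicontinuity on length p + n is the invariant of the
    inductions. *)
Lemma iter_intS n f pre : iter_int n.+1 (fun s => f (pre ++ s)) =
  (\int[mu]_x iter_int n (fun s => f (rcons pre x ++ s)))%E.
Proof. by rewrite /=; under [in RHS]eq_integral do under eq_fun do rewrite cat_rcons. Qed.

Lemma iter_int_ge0 n f : (forall s, 0 <= f s)%E -> (0 <= iter_int n f)%E.
Proof.
by elim: n f => [f|n IH f f0] //=; apply: integral_ge0 => x _; exact: IH.
Qed.

Lemma le_iter_int n f g : (forall s, 0 <= f s)%E -> (forall s, f s <= g s)%E ->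
  (iter_int n f <= iter_int n g)%E.
Proof.
elim: n f g => [f g|n IH f g f0 fg] //=.
by apply: ge0_le_integral_nonmeas => x; [exact: iter_int_ge0|exact: IH].
Qed.

Lemma lscn_iter_int p n f : (forall s, 0 <= f s)%E -> lscn (p + n) f ->
  lscn p (fun pre => iter_int n (fun s => f (pre ++ s))).
Proof.
elim: n p f => [|n IH] p f f0 lf.
  move=> u s su ss us /=; rewrite cats0.
  rewrite (_ : _ \o _ = f \o u); last by apply/funext => k /=; rewrite cats0.
  by apply: lf; rewrite ?addn0.
have := lscn_integral (fun _ => iter_int_ge0 n (fun _ => f0 _)) (IH p.+1 f f0 _).
rewrite addSnnS => /(_ lf).
rewrite (_ : (fun pre => iter_int n.+1 (fun s => f (pre ++ s))) =
  (fun pre => \int[mu]_x iter_int n (fun s => f (rcons pre x ++ s)))%E)//.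
by apply/funext => pre; exact: iter_intS.
Qed.

Lemma iter_intD p n f g pre : size pre = p ->
  (forall s, 0 <= f s)%E -> (forall s, 0 <= g s)%E ->
  lscn (p + n) f -> lscn (p + n) g ->
  iter_int n (fun s => f (pre ++ s) + g (pre ++ s))%E =
  (iter_int n (fun s => f (pre ++ s)) + iter_int n (fun s => g (pre ++ s)))%E.
Proof.
elim: n p pre => [|n IH] p pre sp f0 g0 lf lg; first by [].
rewrite (iter_intS n (fun s => f s + g s)%E) !iter_intS.
rewrite -ge0_integralD//; first last.
- apply: (@lscn_measurable p (fun q => iter_int n (fun s => g (q ++ s))) pre _ sp).
  by apply: lscn_iter_int => //; rewrite addSnnS.
- by move=> x _; exact: iter_int_ge0.
- apply: (@lscn_measurable p (fun q => iter_int n (fun s => f (q ++ s))) pre _ sp).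
  by apply: lscn_iter_int => //; rewrite addSnnS.
- by move=> x _; exact: iter_int_ge0.
apply: eq_integral => x _; apply: (IH p.+1); rewrite ?addSnnS//.
by rewrite size_rcons sp.
Qed.

Lemma iter_intZ p n f pre (c : R) : size pre = p -> 0 <= c ->
  (forall s, 0 <= f s)%E -> lscn (p + n) f ->
  iter_int n (fun s => c%:E * f (pre ++ s))%E =
  (c%:E * iter_int n (fun s => f (pre ++ s)))%E.
Proof.
elim: n p pre => [|n IH] p pre sp c0 f0 lf; first by [].
rewrite (iter_intS n (fun s => c%:E * f s)%E) !iter_intS.
rewrite -ge0_integralZl//; first last.
- by move=> x _; exact: iter_int_ge0.
- apply: (@lscn_measurable p (fun q => iter_int n (fun s => f (q ++ s))) pre _ sp).
  by apply: lscn_iter_int => //; rewrite addSnnS.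
apply: eq_integral => x _; apply: (IH p.+1); rewrite ?addSnnS//.
by rewrite size_rcons sp.
Qed.

Lemma lscn_continuous p (g : seq R -> R) :
  (forall (u : nat -> seq R) s,
    (forall i, (fun k => nth 0 (u k) i) @ \oo --> nth 0 s i) ->
    (g \o u) @ \oo --> g s) -> lscn p (EFin \o g).
Proof.
move=> cg u s _ _ /cg gu.
have /cvg_limn_einf_sup[-> //] : (fun k => (g (u k))%:E) @ \oo --> (g s)%:E.
by apply: cvg_EFin gu; exact: nearW.
Qed.

End LowerSemicontinuousIntegrals.

(** * Goursat's theorem and the mean value property *)

Section Goursat.
Variable R : realType.
Local Notation mu := (@lebesgue_measure R).

Local Notation rint f a b := (\int[mu]_(x in `[a, b]) f x).

Lemma continuous_integrable_itv (f : R -> R) a b : continuous f ->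
  mu.-integrable `[a, b] (EFin \o f).
Proof.
move=> cf; apply: continuous_compact_integrable; first exact: segment_compact.
exact: continuous_subspaceT.
Qed.

Lemma rint_split (f : R -> R) a m b : continuous f -> a <= m -> m <= b ->
  rint f a b = rint f a m + rint f m b.
Proof.
move=> cf am mb; apply/eqP; rewrite addrC -subr_eq; apply/eqP.
rewrite Rintegral_itvB ?bnd_simp//; last exact: continuous_integrable_itv.
rewrite Rintegral_itv_obnd_cbnd//.
apply: integrableS (continuous_integrable_itv m b cf) => //.
by apply: subset_itvr; rewrite bnd_simp.
Qed.

Lemma rint_cst (k : R) a b : a <= b -> rint (fun=> k) a b = k * (b - a).
Proof.
move=> ab; rewrite Rintegral_cst//.
have := lebesgue_measure_itv `[a, b]; rewrite /= lte_fin => ->.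
by move: ab; rewrite le_eqVlt => /predU1P[->|->]; rewrite ?ltxx ?subrr.
Qed.

Lemma rintB (f g : R -> R) a b : continuous f -> continuous g ->
  rint (fun x => f x - g x) a b = rint f a b - rint g a b.
Proof. by move=> cf cg; rewrite RintegralB//; exact: continuous_integrable_itv. Qed.

Lemma rint_near_cst (f : R -> R) a b (k e : R) : continuous f -> a <= b ->
  (forall x, a <= x <= b -> `|f x - k| <= e) ->
  `|rint f a b - k * (b - a)| <= e * (b - a).
Proof.
move=> cf ab fk; rewrite -!rint_cst// -rintB//; last exact: cst_continuous.
have cg : continuous (fun x => f x - k).
  by move=> x; apply: cvgB; [exact: cf|exact: cvg_cst].
rewrite (le_trans (le_normr_Rintegral _ _))//; first exact: continuous_integrable_itv.
apply: le_Rintegral => //.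
- by apply: continuous_integrable_itv => x; apply: cvg_norm; exact: cg.
- by apply: continuous_integrable_itv; exact: cst_continuous.
Qed.

Definition diff2 (P : R -> R -> R) (x y p q : R) := forall e : R, 0 < e ->
  exists2 delta : R, 0 < delta & forall a b : R, `|a| < delta -> `|b| < delta ->
    `|P (x + a) (y + b) - P x y - p * a - q * b| <= e * (`|a| + `|b|).

(** The counterclockwise circulation of P dx + Q dy around the rectangle with sides [a, b] and
    [c, d]. *)
Definition rect_int (P Q : R -> R -> R) (a b c d : R) :=
  rint (fun x => P x c - P x d) a b + rint (fun y => Q b y - Q a y) c d.

Section closed_form.
Variables P Q : R -> R -> R.
Hypothesis cPx : forall y, continuous (P^~ y).
Hypothesis cQy : forall x, continuous (Q x).
(* The differential form P dx + Q dy is closed. *)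
Hypothesis dPQ : forall x y, exists p r q, diff2 P x y p r /\ diff2 Q x y r q.

Let cPB c d : continuous (fun x => P x c - P x d).
Proof. by move=> x; apply: cvgB; exact: cPx. Qed.

Let cQB c d : continuous (fun y => Q c y - Q d y).
Proof. by move=> x; apply: cvgB; exact: cQy. Qed.

Let rect_splitx a m b c d : a <= m -> m <= b ->
  rect_int P Q a b c d = rect_int P Q a m c d + rect_int P Q m b c d.
Proof.
move=> am mb; rewrite /rect_int (rint_split (@cPB c d) am mb) !rintB//; ring.
Qed.

Let rect_splity a b c m d : c <= m -> m <= d ->
  rect_int P Q a b c d = rect_int P Q a b c m + rect_int P Q a b m d.
Proof.
move=> am mb; rewrite /rect_int (rint_split (@cQB b a) am mb) !rintB//; ring.
Qed.

Let dist_arith (a w x t : R) : a <= x -> x <= a + w -> a <= t <= a + w -> `|t - x| <= w.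
Proof.
by move=> ? ? /andP[? ?]; rewrite ler_norml; apply/andP; split; lra.
Qed.

Let half (n : nat) : R := 2^-1 ^+ n.

Let half_gt0 n : 0 < half n.
Proof. by rewrite exprn_gt0. Qed.

Let halfS n : half n = half n.+1 + half n.+1.
Proof. by rewrite /half exprS; field. Qed.

Let half_small (e : R) : 0 < e -> exists n, half n < e.
Proof.
move=> e0; have /cvgrPdist_lt/(_ _ e0)[N _ HN] : half @ \oo --> (0 : R).
  by apply: cvg_expr; rewrite ger0_norm ?invr_ge0// invf_lt1 ?ltr1n.
exists N; have := HN N (leqnn _).
by rewrite /= sub0r normrN ger0_norm ?ltW.
Qed.

Let nested_point (w : R) (a : nat -> R) : 0 <= w ->
  (forall n, a n <= a n.+1 /\ a n.+1 + w * half n.+1 <= a n + w * half n) ->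
  exists x, forall n, a n <= x /\ x <= a n + w * half n.
Proof.
move=> w0 H.
have Hm n k : a n <= a (n + k)%N /\ a (n + k)%N + w * half (n + k) <= a n + w * half n.
  elim: k => [|k [IH1 IH2]]; first by rewrite addn0.
  rewrite addnS; have [h1 h2] := H (n + k)%N.
  by split; [exact: le_trans h1|exact: le_trans IH2].
have ub n m : a m <= a n + w * half n.
  have [mn|/ltnW nm] := leqP m n.
    have [h _] := Hm m (n - m)%N; move: h; rewrite subnKC// => /le_trans; apply.
    by rewrite lerDl mulr_ge0// ltW.
  have [_ h] := Hm n (m - n)%N; move: h; rewrite subnKC//; apply: le_trans.
  by rewrite lerDl mulr_ge0// ltW.
have hs : has_sup (range a).
  by split; [exists (a 0%N), 0%N|exists (a 0%N + w * half 0) => _ [m _ <-]].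
exists (sup (range a)) => n; split.
  by apply: ub_le_sup; [exact: hs.2|exists n].
by apply: ge_sup; [exact: hs.1|move=> _ [m _ <-]].
Qed.

(** Bisection: one of the four quarters always retains a quarter of the integral, so at scale 2^-n
    it is at least E 4^-n. At the common point of the nested rectangles the affine parts of P and Q
    integrate to 0, and the remainder is smaller than E 4^-n. *)
Lemma goursat_rect a c w h : 0 <= w -> 0 <= h ->
  rect_int P Q a (a + w) c (c + h) = 0.
Proof.
move=> w0 h0; apply/eqP/negPn/negP => J0.
pose J n (z : R * R) := rect_int P Q z.1 (z.1 + w * half n) z.2 (z.2 + h * half n).
pose E := `|rect_int P Q a (a + w) c (c + h)|.
have E0 : 0 < E by rewrite normr_gt0.
pose good n z := E * half n ^+ 2 <= `|J n z|.
(* The conclusion is conditional on [good] so that [choice] yields a total function; goodness along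
   the chain is recovered by induction. *)
have step (zn : (R * R) * nat) : exists z', good zn.2 zn.1 ->
    [/\ good zn.2.+1 z',
      zn.1.1 <= z'.1 /\ z'.1 + w * half zn.2.+1 <= zn.1.1 + w * half zn.2 &
      zn.1.2 <= z'.2 /\ z'.2 + h * half zn.2.+1 <= zn.1.2 + h * half zn.2].
  move: zn => [[x y] n] /=.
  have [gn|] := pselect (good n (x, y)); last by exists (x, y).
  set w' := w * half n.+1; set h' := h * half n.+1.
  have w'0 : 0 <= w' by rewrite mulr_ge0// ltW.
  have h'0 : 0 <= h' by rewrite mulr_ge0// ltW.
  have ww : w * half n = w' + w' by rewrite halfS mulrDr.
  have hh : h * half n = h' + h' by rewrite halfS mulrDr.
  have Jsum : J n (x, y) = J n.+1 (x, y) + J n.+1 (x + w', y) +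
      (J n.+1 (x, y + h') + J n.+1 (x + w', y + h')).
    rewrite /J /= -/w' -/h' ww hh !addrA.
    rewrite (@rect_splity _ _ _ (y + h')) ?lerDl//.
    rewrite (@rect_splitx x (x + w') _ y) ?lerDl//.
    by rewrite (@rect_splitx x (x + w') _ (y + h')) ?lerDl ?addrA.
  have [z [gz h1 h2]] : exists z, [/\ good n.+1 z, z = (x, y) \/ z = (x + w', y) \/
      z = (x, y + h') \/ z = (x + w', y + h') & True].
    apply: contrapT => Hz.
    have small z : z = (x, y) \/ z = (x + w', y) \/
      z = (x, y + h') \/ z = (x + w', y + h') -> `|J n.+1 z| < E * half n.+1 ^+ 2.
      by move=> zz; rewrite ltNge; apply/negP => gz; apply: Hz; exists z.
    have s1 := small (x, y) (or_introl erefl).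
    have s2 := small (x + w', y) (or_intror (or_introl erefl)).
    have s3 := small (x, y + h') (or_intror (or_intror (or_introl erefl))).
    have s4 := small (x + w', y + h') (or_intror (or_intror (or_intror erefl))).
    move: gn; rewrite /good Jsum; apply/negP; rewrite -ltNge.
    rewrite (le_lt_trans (ler_normD _ _))//.
    have n1 := ler_normD (J n.+1 (x, y)) (J n.+1 (x + w', y)).
    have n2 := ler_normD (J n.+1 (x, y + h')) (J n.+1 (x + w', y + h')).
    have -> : E * half n ^+ 2 = 4 * (E * half n.+1 ^+ 2) by rewrite halfS; ring.
    lra.
  exists z => _; rewrite ww hh.
  by case: h1 => [->|[->|[->|->]]] in gz *; split=> //=; split;
    rewrite ?addrA ?lexx ?lerDl// -?addrA ?lerD2l ?lerDl.
have /choice[f Hf] := step.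
pose z := fix z n := if n is n'.+1 then f (z n', n') else (a, c).
have gz n : good n (z n).
  elim: n => [|n IH]; last by have [] := Hf (z n, n) IH.
  by rewrite /good /J /half /= !expr0 expr1n !mulr1.
have zS n : _ := Hf (z n, n) (gz n).
have [x Hx] : exists x, forall n, (z n).1 <= x /\ x <= (z n).1 + w * half n.
  by apply: nested_point => // n; case: (zS n).
have [y Hy] : exists y, forall n, (z n).2 <= y /\ y <= (z n).2 + h * half n.
  by apply: nested_point => // n; case: (zS n).
have [p [r [q [dP dQ]]]] := dPQ x y.
(* Chosen so that the final bound 2 e (w + h)^2 is at most E/2; the summand 1 covers w = h = 0. *)
pose e := E / (4 * (w + h + 1) ^+ 2).
have wh0 : 0 < w + h + 1 by rewrite ltr_wpDl// addr_ge0.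
have e0 : 0 < e by rewrite divr_gt0// mulr_gt0// exprn_gt0.
have [d1 d10 H1] := dP _ e0; have [d2 d20 H2] := dQ _ e0.
have [n hn] : exists n, half n < Num.min d1 d2 / (w + h + 1).
  by apply: half_small; rewrite divr_gt0// lt_min d10.
have := gz n; rewrite /good; apply/negP; rewrite -ltNge.
have {Hx} [x1 x2] := Hx n; have {Hy} [y1 y2] := Hy n.
have hp := half_gt0 n.
have {hn} : (w + h + 1) * half n < Num.min d1 d2 by rewrite mulrC -ltr_pdivlMr.
rewrite lt_min /J => /andP[hd1 hd2].
set a' := (z n).1 in x1 x2 *; set c' := (z n).2 in y1 y2 *.
set w' := w * half n in x2 *; set h' := h * half n in y2 *.
have w'0 : 0 <= w' by rewrite mulr_ge0// ltW.
have h'0 : 0 <= h' by rewrite mulr_ge0// ltW.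
have whd : (w + h + 1) * half n = w' + h' + half n by rewrite /w' /h'; ring.
rewrite whd in hd1 hd2.
have bx t : a' <= t <= a' + w' -> `|t - x| <= w'.
  exact: dist_arith x1 x2.
have bY t : c' <= t <= c' + h' -> `|t - y| <= h'.
  exact: dist_arith y1 y2.
have approxP s t : a' <= s <= a' + w' -> c' <= t <= c' + h' ->
    `|P s t - P x y - p * (s - x) - r * (t - y)| <= e * (w' + h').
  move=> /bx bs /bY bt; have := H1 (s - x) (t - y).
  rewrite ![_ + (_ - _)]addrC !subrK => H; apply: (le_trans (H _ _)).
  - by apply: le_lt_trans bs _; apply: le_lt_trans hd1; rewrite -addrA lerDl addr_ge0// ltW.
  - by apply: le_lt_trans bt _; apply: le_lt_trans hd1; rewrite addrAC lerDr addr_ge0// ltW.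
  by rewrite ler_pM2l// lerD.
have approxQ s t : a' <= s <= a' + w' -> c' <= t <= c' + h' ->
    `|Q s t - Q x y - r * (s - x) - q * (t - y)| <= e * (w' + h').
  move=> /bx bs /bY bt; have := H2 (s - x) (t - y).
  rewrite ![_ + (_ - _)]addrC !subrK => H; apply: (le_trans (H _ _)).
  - by apply: le_lt_trans bs _; apply: le_lt_trans hd2; rewrite -addrA lerDl addr_ge0// ltW.
  - by apply: le_lt_trans bt _; apply: le_lt_trans hd2; rewrite addrAC lerDr addr_ge0// ltW.
  by rewrite ler_pM2l// lerD.
have ec : c' <= c' <= c' + h' by rewrite lexx lerDl.
have ec' : c' <= c' + h' <= c' + h' by rewrite lexx lerDl h'0.
have ea : a' <= a' <= a' + w' by rewrite lexx lerDl.
have ea' : a' <= a' + w' <= a' + w' by rewrite lexx lerDl w'0.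
(* The affine part of bottom minus top is - r h', that of right minus left is r w'. Multiplied by
   the side lengths they cancel, because the y-derivative of P and the x-derivative of Q are the
   same r. *)
have i1 : `|rint (fun s => P s c' - P s (c' + h')) a' (a' + w') - (- r * h') * (a' + w' - a')|
    <= 2 * (e * (w' + h')) * (a' + w' - a').
  apply: rint_near_cst; rewrite ?lerDl// => s hs.
  have -> : P s c' - P s (c' + h') - - r * h' =
    (P s c' - P x y - p * (s - x) - r * (c' - y)) -
    (P s (c' + h') - P x y - p * (s - x) - r * (c' + h' - y)) by ring.
  rewrite (le_trans (ler_normB _ _))// mulr_natl mulr2n.
  by apply: lerD; apply: approxP.
have i2 : `|rint (fun t => Q (a' + w') t - Q a' t) c' (c' + h') - (r * w') * (c' + h' - c')|
    <= 2 * (e * (w' + h')) * (c' + h' - c').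
  apply: rint_near_cst; rewrite ?lerDl// => t ht.
  have -> : Q (a' + w') t - Q a' t - r * w' =
    (Q (a' + w') t - Q x y - r * (a' + w' - x) - q * (t - y)) -
    (Q a' t - Q x y - r * (a' - x) - q * (t - y)) by ring.
  rewrite (le_trans (ler_normB _ _))// mulr_natl mulr2n.
  by apply: lerD; apply: approxQ.
have ew : a' + w' - a' = w' by ring.
have eh : c' + h' - c' = h' by ring.
rewrite ew in i1; rewrite eh in i2.
have bound : `|rect_int P Q a' (a' + w') c' (c' + h')| <= 2 * e * (w' + h') ^+ 2.
  have key (A B : R) : `|A - - r * h' * w'| <= 2 * (e * (w' + h')) * w' ->
      `|B - r * w' * h'| <= 2 * (e * (w' + h')) * h' -> `|A + B| <= 2 * e * (w' + h') ^+ 2;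
    last exact: key i1 i2.
  move=> {i1 i2} i1 i2.
  have -> : A + B = (A - - r * h' * w') + (B - r * w' * h') by ring.
  rewrite (le_trans (ler_normD _ _))//.
  have -> : 2 * e * (w' + h') ^+ 2 = 2 * (e * (w' + h')) * w' + 2 * (e * (w' + h')) * h' by ring.
  exact: lerD.
apply: (le_lt_trans bound).
have -> : w' + h' = (w + h) * half n by rewrite /w' /h'; ring.
rewrite exprMn mulrA ltr_pM2r ?exprn_gt0//.
have le1 : (w + h) ^+ 2 <= (w + h + 1) ^+ 2.
  by rewrite ler_pXn2r// ?nnegrE ?addr_ge0// lerDl.
have : 2 * e * (w + h) ^+ 2 <= 2 * e * (w + h + 1) ^+ 2.
  by rewrite ler_wpM2l// mulr_ge0// ltW.
have -> : 2 * e * (w + h + 1) ^+ 2 = E / 2.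
  by rewrite /e; field; rewrite gt_eqF.
by move=> hE; rewrite (le_lt_trans hE)// ltr_pdivrMr// ltr_pMr// ltr1n.
Qed.

End closed_form.
End Goursat.

Section MeanValue.
Variable R : realType.
Local Notation mu := (@lebesgue_measure R).

Lemma cdiff_continuous (k : R[i] -> R[i]) z (e : R) : cdiff k -> 0 < e ->
  exists2 delta : R, 0 < delta &
    forall h, cabs h < delta -> cabs (k (z + h) - k z) < e.
Proof.
move=> /(_ z)[L /cderiv_lip[d d0 H]] e0.
have l0 : 0 < 1 + cabs L by rewrite ltr_pwDl ?cabs_ge0.
exists (Num.min d (e / (1 + cabs L))); first by rewrite lt_min d0 divr_gt0.
move=> h; rewrite lt_min => /andP[/H hd]; rewrite ltr_pdivlMr// mulrC.
exact: le_lt_trans.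
Qed.

Lemma cdiff_cvg (k : R[i] -> R[i]) (x y : R^nat) (a b : R) : cdiff k ->
  x @ \oo --> a -> y @ \oo --> b ->
  (fun n => complex.Re (k (x n +i* y n))) @ \oo --> complex.Re (k (a +i* b)) /\
  (fun n => complex.Im (k (x n +i* y n))) @ \oo --> complex.Im (k (a +i* b)).
Proof.
move=> dk xa yb.
suff H : forall e : R, 0 < e -> \forall n \near \oo,
    cabs (k (x n +i* y n) - k (a +i* b)) < e.
  split; apply/cvgrPdist_lt => e /H; apply: filterS => n; rewrite distrC => he.
    by apply: le_lt_trans he; rewrite -ReN -ReD normRe_cabs.
  by apply: le_lt_trans he; rewrite -ImN -ImD normIm_cabs.
move=> e /(cdiff_continuous (a +i* b) dk)[d d0 Hd].
have d20 : 0 < d / 2 by rewrite divr_gt0.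
move/cvgrPdist_lt : xa => /(_ _ d20) xa; move/cvgrPdist_lt : yb => /(_ _ d20) yb.
near=> n.
have -> : x n +i* y n = (a +i* b) + ((x n - a) +i* (y n - b)).
  by apply/eqP; rewrite eq_complex /=; apply/andP; split; apply/eqP; ring.
apply: Hd; rewrite (le_lt_trans (cabs_ReIm _))//=.
have : `|a - x n| < d / 2 by near: n.
have : `|b - y n| < d / 2 by near: n.
rewrite distrC => h1; rewrite distrC => h2; lra.
Unshelve. all: end_near. Qed.

Lemma continuous_line (k : R[i] -> R[i]) (p q : R[i]) : cdiff k ->
  continuous (fun t : R => complex.Re (k (p + q * t%:C))).
Proof.
move=> dk t; apply/cvgrPdist_lt => e e0.
have [d d0 H] := cdiff_continuous t%:C (cdiff_comp dk (cdiff_lin q p)) e0.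
near=> s; rewrite distrC -ReN -ReD (le_lt_trans (normRe_cabs _))//.
have -> : p + q * s%:C = q * (t%:C + (s - t)%:C) + p.
  by rewrite -rmorphD [t + _]addrC subrK addrC.
rewrite [p + _]addrC; have := H (s - t)%:C; rewrite /= cabs_real.
by apply; near: s; exists d => //= r; rewrite distrC.
Unshelve. all: end_near. Qed.

(** Cauchy-Riemann: the shared entry [complex.Re L] says that Im k dx + Re k dy, the imaginary part
    of k dz, is closed. *)
Lemma cderiv_diff2 (k : R[i] -> R[i]) x y L : cderiv k (x +i* y) L ->
  diff2 (fun a b => complex.Im (k (a +i* b))) x y (complex.Im L) (complex.Re L) /\
  diff2 (fun a b => complex.Re (k (a +i* b))) x y (complex.Re L) (- complex.Im L).
Proof.
move=> dk.
suff H (e : R) : 0 < e -> exists2 d : R, 0 < d & forall a b, `|a| < d -> `|b| < d ->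
    cabs (k ((x + a) +i* (y + b)) - k (x +i* y) - L * (a +i* b)) <= e * (`|a| + `|b|).
  split=> e /H[d d0 Hd]; exists d => // a b ad bd; apply: le_trans (Hd _ _ ad bd).
    apply: le_trans (normIm_cabs _); rewrite !ImD !ImN ImM /=.
    by rewrite le_eqVlt; apply/orP; left; apply/eqP; congr `|_|; ring.
  apply: le_trans (normRe_cabs _); rewrite !ReD !ReN ReM /=.
  by rewrite le_eqVlt; apply/orP; left; apply/eqP; congr `|_|; ring.
move=> e0; have [d d0 Hd] := dk _ e0; exists (d / 2); first by rewrite divr_gt0.
move=> a b ha hb; have hab := cabs_ReIm (a +i* b).
have := Hd (a +i* b); have -> : (x +i* y) + (a +i* b) = (x + a) +i* (y + b) by [].
move=> /(_ _)/le_trans; apply; last by rewrite ler_wpM2l// ltW.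
by rewrite (le_lt_trans hab)//=; lra.
Qed.

(** Composition with z exp(zeta) turns circles into vertical segments. Goursat on [s, 0] x
    [-pi, pi], whose horizontal sides cancel by 2 pi i periodicity, makes the mean independent of s,
    and s -> -oo gives the value at 0. *)
Lemma circle_mean (h : R[i] -> R[i]) z : cdiff h ->
  \int[mu]_(t in `[- pi, pi]) complex.Re (h (z * cexp (0 +i* t))) =
  complex.Re (h 0) * (2 * pi).
Proof.
move=> dh; pose k zeta := h (z * cexp zeta).
have dk : cdiff k.
  by apply: (cdiff_comp dh); apply: cdiffM; [exact: cdiff_cst|exact: cdiff_cexp].
pose Q (x y : R) := complex.Re (k (x +i* y)).
pose P (x y : R) := complex.Im (k (x +i* y)).
have cQ x : continuous (Q x).
  have := @continuous_line k (x +i* 0) 'i%C dk.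
  rewrite (_ : (fun _ => _) = Q x)//; apply/funext => t; rewrite /Q; congr (complex.Re (k _)).
  by apply/eqP; rewrite eq_complex /= !(mul0r,mulr0,mul1r,addr0,add0r,subr0) !eqxx.
have cP y : continuous (P^~ y).
  (* Re(- i k) = Im k, so continuity of imaginary parts is an instance of that of real parts. *)
  have dk' : cdiff (fun t => - 'i%C * k t).
    by apply: cdiffM => //; exact: cdiff_cst.
  have := @continuous_line _ (0 +i* y) 1 dk'.
  rewrite (_ : (fun _ => _) = P^~ y)//; apply/funext => t; rewrite /P ReM /=.
  rewrite oppr0 mul0r sub0r mulN1r opprK; congr (complex.Im (k _)).
  by apply/eqP; rewrite eq_complex /= !(mul0r,mulr0,mul1r,addr0,add0r,subr0) !eqxx.
have dPQ x y : exists p r q, diff2 P x y p r /\ diff2 Q x y r q.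
  have [L /cderiv_diff2 H] := dk (x +i* y).
  by exists (complex.Im L), (complex.Re L), (- complex.Im L).
have pi2 : - pi + 2 * pi = pi :> R by ring.
have const s : s <= 0 ->
    \int[mu]_(t in `[- pi, pi]) Q 0 t = \int[mu]_(t in `[- pi, pi]) Q s t.
  move=> s0.
  have ns0 : 0 <= - s by rewrite oppr_ge0.
  have pp0 : 0 <= 2 * pi :> R by rewrite mulr_ge0 ?pi_ge0.
  have := goursat_rect cP cQ dPQ s (- pi) ns0 pp0.
  rewrite subrr pi2 /rect_int.
  have -> : (fun x => P x (- pi) - P x pi) = (fun=> 0).
    apply/funext => x; rewrite /P /k /cexp /= cosN sinN sinpi cospi oppr0.
    by rewrite subrr.
  have -> := etrans (rint_cst 0 s0) (mul0r _).
  have -> := @rintB R (Q 0) (Q s) (- pi) pi (cQ 0) (cQ s).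
  by rewrite add0r => /eqP; rewrite subr_eq0 => /eqP.
have pipi : - pi <= pi :> R by rewrite ge0_cp ?pi_ge0.
suff near0 (e : R) : 0 < e ->
    `|\int[mu]_(t in `[- pi, pi]) Q 0 t - complex.Re (h 0) * (2 * pi)| <= e * (2 * pi).
  rewrite /Q /k in near0 *; apply/eqP; rewrite -subr_eq0 -normr_le0.
  apply/ler_addgt0Pr => e e0; rewrite add0r.
  have pp : 0 < 2 * pi :> R by rewrite mulr_gt0// pi_gt0.
  have e20 : 0 < e / (2 * pi) by rewrite divr_gt0.
  by rewrite (le_trans (near0 _ e20))// mulfVK// gt_eqF.
move=> e0; have [d d0 Hd] := cdiff_continuous 0 dh e0.
(* Take e^s = min(1, d / (1 + |z|)); the 1 added to |z| keeps the quotient meaningful and the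
   inequality strict when z = 0. *)
have [s s0 sd] : exists2 s : R, s <= 0 & cabs z * expR s < d.
  pose r := Num.min 1 (d / (1 + cabs z)).
  have z1 : 0 < 1 + cabs z by rewrite ltr_pwDl ?cabs_ge0.
  have r0 : 0 < r by rewrite lt_min ltr01 divr_gt0.
  exists (ln r); first by rewrite ln_le0// ge_min lexx.
  rewrite lnK ?posrE// (@lt_le_trans _ _ ((1 + cabs z) * r))//.
    by rewrite ltr_pM2r// ltrDr.
  by rewrite mulrC -ler_pdivlMr// ge_min lexx orbT.
rewrite (const s s0).
have := @rint_near_cst R (Q s) (- pi) pi (complex.Re (h 0)) e (cQ s) pipi.
rewrite opprK -[pi + pi]mulr2n -[pi *+ 2]mulr_natl; apply => t _.
rewrite /Q /k -ReN -ReD (le_trans (normRe_cabs _))// ltW//.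
have := Hd (z * cexp (s +i* t)); rewrite add0r; apply.
by rewrite cabsM cabs_cexp.
Qed.

(** Integrates |h|^2 >= 2 Re(h conj(h(0))) - |h(0)|^2, using the mean value property of h
    conj(h(0)). *)
Lemma circle_submean (h : R[i] -> R[i]) z : cdiff h ->
  cabs2 (h 0) * (2 * pi) <= \int[mu]_(t in `[- pi, pi]) cabs2 (h (z * cexp (0 +i* t))).
Proof.
move=> dh; pose h1 t := h t * (conjc (h 0)).
have dh1 : cdiff h1 by apply: cdiffM => //; exact: cdiff_cst.
have := circle_mean z dh1.
have -> : complex.Re (h1 0) = cabs2 (h 0).
  by rewrite /h1 ReM Re_conj Im_conj /cabs2; ring.
move=> E.
have cts (g : R[i] -> R[i]) : cdiff g ->
    continuous (fun t : R => complex.Re (g (z * cexp (0 +i* t)))).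
  move=> dg; have := @continuous_line (fun t => g (z * cexp t)) 0 'i%C.
  rewrite (_ : (fun _ => _) = (fun t : R => complex.Re (g (z * cexp (0 +i* t))))).
    apply; apply: (cdiff_comp dg).
    by apply: cdiffM; [exact: cdiff_cst|exact: cdiff_cexp].
  apply/funext => t; congr (complex.Re (g (z * cexp _))).
  rewrite add0r; apply/eqP; rewrite eq_complex /= !(mul0r,mulr0,mul1r,addr0,add0r,subr0).
  by rewrite oppr0 !eqxx.
have c1 := cts _ dh1; have c2 := cts _ dh.
have c3 : continuous (fun t : R => complex.Im (h (z * cexp (0 +i* t)))).
  have := cts (fun t => - 'i%C * h t); rewrite (_ : (fun _ => _) =
    (fun t : R => complex.Im (h (z * cexp (0 +i* t))))).
    by apply; apply: cdiffM => //; exact: cdiff_cst.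
  by apply/funext => t; rewrite ReM /= oppr0 mul0r sub0r mulN1r opprK.
set f := (fun t : R => complex.Re (h1 _)) in c1 *.
have c4 : continuous (fun t : R => cabs2 (h (z * cexp (0 +i* t)))).
  by move=> t; rewrite /cabs2; apply: cvgD; apply: cvgM; (exact: c2 || exact: c3).
have c5 : continuous (fun t => f t - cabs2 (h 0)).
  by move=> t; apply: cvgB; [exact: c1|exact: cvg_cst].
have pipi : - pi <= pi :> R by rewrite ge0_cp ?pi_ge0.
have pi2 : pi - - pi = 2 * pi :> R by ring.
have E2 : \int[mu]_(t in `[- pi, pi]) (f t - cabs2 (h 0)) = 0.
  by rewrite rintB// ?rint_cst ?E ?pi2 ?subrr//; exact: cst_continuous.
(* The integrand is the lower bound 2 f - |h(0)|^2, arranged as a difference of continuous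
   functions; E2 says that f - |h(0)|^2 has integral 0. *)
have E3 : \int[mu]_(t in `[- pi, pi]) (f t - (- (f t - cabs2 (h 0)))) =
    cabs2 (h 0) * (2 * pi).
  rewrite rintB//; last by move=> t; apply: cvgN; exact: c5.
  rewrite -[RHS]E -[RHS]subr0; congr (_ - _).
  have <- : \int[mu]_(t in `[- pi, pi]) (0 - (f t - cabs2 (h 0))) = 0.
    by rewrite rintB ?E2 ?subr0 ?rint_cst ?mul0r//; exact: cst_continuous.
  by apply: eq_Rintegral => t _; rewrite sub0r.
rewrite -E3; apply: le_Rintegral => //.
- apply: continuous_integrable_itv => t.
  by apply: cvgB; [exact: c1|apply: cvgN; exact: c5].
- exact: continuous_integrable_itv.
move=> t _; rewrite /f /h1 ReM Re_conj Im_conj /cabs2.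
set a := complex.Re _; set b := complex.Im _; set c := complex.Re _; set d := complex.Im _.
have := sqr_ge0 (a - c); have := sqr_ge0 (b - d); nra.
Qed.

End MeanValue.

(** * The Gaussian mean value inequality in the plane *)

Section GaussianSubmean.
Variable R : realType.
Local Notation mu := (@lebesgue_measure R).

Lemma gauss_int (a c : R) : 0 < a ->
  (\int[mu]_x (expR (- a * (x - c) ^+ 2))%:E = (Num.sqrt (pi / a))%:E)%E.
Proof.
(* The standard deviation of the normal law whose density is proportional to exp(- a (x - c)^2). *)
move=> a0; pose s := Num.sqrt (2 * a)^-1.
have s2 : s ^+ 2 = (2 * a)^-1 by rewrite sqr_sqrtr// invr_ge0 mulr_ge0// ltW.
have s0 : s != 0 by rewrite gt_eqF// sqrtr_gt0 invr_gt0 mulr_gt0.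
have sp : 0 < Num.sqrt (pi / a) by rewrite sqrtr_gt0 divr_gt0// pi_gt0.
have := integral_normal_pdf c s; rewrite normal_pdfE// /normal_peak /normal_fun s2.
have -> : (2 * a)^-1 * pi *+ 2 = pi / a by field; rewrite gt_eqF.
have fE x : (expR (- a * (x - c) ^+ 2))%:E = ((Num.sqrt (pi / a))%:E *
    ((Num.sqrt (pi / a))^-1 * expR (- (x - c) ^+ 2 / ((2 * a)^-1 *+ 2)))%:E)%E.
  rewrite -EFinM mulVKf ?gt_eqF//; congr (expR _)%:E.
  by field; rewrite gt_eqF.
under [in X in _ -> X]eq_integral do rewrite fE.
rewrite ge0_integralZl ?lee_fin ?ltW//; first by move=> ->; rewrite mule1.
apply/measurable_EFinP; apply: measurable_funM => //.
apply: measurableT_comp => //=; apply: measurable_funM => //=.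
apply: measurableT_comp => //=; apply: measurable_funX => //=.
exact: measurable_funD.
Qed.

Lemma ge0_integral_shift (f : R -> R) (a : R) : continuous f ->
  (forall x, 0 <= f x) ->
  (\int[mu]_x (f (x + a))%:E = \int[mu]_x (f x)%:E)%E.
Proof.
move=> cf f0; pose F (x : R) := x + a.
have dF (x : R) : is_derive x (1 : R) F 1.
  by rewrite -[X in is_derive _ _ _ X]addr0; apply: is_deriveD.
have F'1 : derive1 F = cst 1 by apply/funext => x; rewrite derive1E derive_val.
rewrite [RHS](@increasing_ge0_integration_by_substitutionT R F f)//.
- by apply: eq_integral => x _; rewrite F'1 /= mulr1.
- by move=> x y xy; rewrite ltrD2r.
- by rewrite F'1; exact: cst_continuous.
- by rewrite F'1; exact: is_cvg_cst.
- by rewrite F'1; exact: is_cvg_cst.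
- by apply/cvgrNyPle => M; exists (M - a); split; [exact: num_real|
    by move=> x xM; rewrite /F; lra].
- by apply/cvgryPge => M; exists (M - a); split; [exact: num_real|
    by move=> x xM; rewrite /F; lra].
Qed.

Definition seq_cont2 (G : R -> R -> R) := forall (x y : R^nat) (a b : R),
  x @ \oo --> a -> y @ \oo --> b -> (fun k => G (x k) (y k)) @ \oo --> G a b.

Lemma seq_cont2_lsc G : seq_cont2 G -> forall (x y : R^nat) (a b : R),
  x @ \oo --> a -> y @ \oo --> b ->
  ((G a b)%:E <= limn_einf (fun k => (G (x k) (y k))%:E))%E.
Proof.
move=> cG x y a b xa yb; have Gc := cG _ _ _ _ xa yb.
have /cvg_limn_einf_sup[-> //] : (fun k => (G (x k) (y k))%:E) @ \oo --> (G a b)%:E.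
by apply: cvg_EFin Gc; exact: nearW.
Qed.

Lemma seq_continuous (f : R -> R) :
  (forall (x : R^nat) a, x @ \oo --> a -> (f \o x) @ \oo --> f a) -> continuous f.
Proof.
move=> H a; apply/cvgrPdist_lt => e e0; apply: contrapT => nH.
have /choice[u Hu] : forall n : nat, exists x, `|a - x| < n.+1%:R^-1 /\ e <= `|f a - f x|.
  move=> n; apply: contrapT => nx; apply: nH.
  exists n.+1%:R^-1 => /=; first by rewrite invr_gt0.
  move=> x /= ax; rewrite ltNge; apply/negP => ex; apply: nx; exists x.
  by split.
have ua : u @ \oo --> a.
  apply/cvgrPdist_lt => d d0.
  have /cvgrPdist_lt/(_ _ d0) := @cvg_harmonic R; apply: filterS => n /=.
  rewrite sub0r normrN ger0_norm// => nd; apply: lt_trans nd.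
  by case: (Hu n).
have /cvgrPdist_lt/(_ _ e0)[N _ HN] := H _ _ ua.
by have := HN N (leqnn _); rewrite /= ltNge; case: (Hu N) => _ ->.
Qed.

Lemma swap_cont2 G : (forall x y, 0 <= G x y) -> seq_cont2 G ->
  (\int[mu]_x \int[mu]_y (G x y)%:E = \int[mu]_y \int[mu]_x (G x y)%:E)%E.
Proof.
move=> G0 cG; apply: (@swap_lsc2 R (fun x y => (G x y)%:E)).
  by move=> x y; rewrite lee_fin.
exact: seq_cont2_lsc.
Qed.

Lemma seq_cont2_shear G t : seq_cont2 G -> seq_cont2 (fun x y => G (x + t * y) y).
Proof.
move=> cG x y a b xa yb; apply: cG => //.
by apply: cvgD => //; apply: cvgM => //; exact: cvg_cst.
Qed.

Lemma seq_cont2_flip G : seq_cont2 G -> seq_cont2 (fun x y => G y x).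
Proof. by move=> cG x y a b xa yb; exact: cG. Qed.

Lemma integral_shear_inner G t : (forall x y, 0 <= G x y) -> seq_cont2 G ->
  (\int[mu]_y \int[mu]_x (G (x + t * y)%R y)%:E = \int[mu]_y \int[mu]_x (G x y)%:E)%E.
Proof.
move=> G0 cG; apply: eq_integral => y _.
apply: (@ge0_integral_shift (fun x => G x y)) => // ; apply: seq_continuous => x a xa.
by apply: (cG x (fun=> y)) => //; exact: cvg_cst.
Qed.

Lemma integral_translate2 G a b : (forall x y, 0 <= G x y) -> seq_cont2 G ->
  (\int[mu]_x \int[mu]_y (G (x + a)%R (y + b)%R)%:E = \int[mu]_x \int[mu]_y (G x y)%:E)%E.
Proof.
move=> G0 cG.
transitivity (\int[mu]_x \int[mu]_y (G (x + a)%R y)%:E)%E.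
  apply: eq_integral => x _.
  apply: (@ge0_integral_shift (fun y => G (x + a) y)) => //; apply: seq_continuous => y c yc.
  by apply: (cG (fun=> x + a) y) => //; exact: cvg_cst.
apply: (etrans (@swap_cont2 (fun x y => G (x + a) y) _ _)) => //.
  move=> x y c e xc ye; apply: cG => //; apply: cvgD => //; exact: cvg_cst.
apply: etrans (esym (swap_cont2 G0 cG)); apply: eq_integral => y _.
apply: (@ge0_integral_shift (fun x => G x y)) => //; apply: seq_continuous => x c xc.
by apply: (cG x (fun=> y)) => //; exact: cvg_cst.
Qed.

(* A rotation is a product of three shears. *)
Lemma integral_rotation G (theta : R) : - pi < theta < pi ->
  (forall x y, 0 <= G x y) -> seq_cont2 G ->
  (\int[mu]_x \int[mu]_y (G (cos theta * x - sin theta * y)%R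
                           (sin theta * x + cos theta * y)%R)%:E =
   \int[mu]_x \int[mu]_y (G x y)%:E)%E.
Proof.
(* The shears are x - t y, y + s x and x - t y again, with t = tan(theta/2) and s = sin theta; the
   range of theta keeps cos(theta/2) away from 0. Each shear is a translation in one variable, so
   Tonelli is used in between to bring that variable inside. *)
move=> th G0 cG; pose t := tan (theta / 2); pose s := sin theta.
have c0 : cos (theta / 2) != 0.
  rewrite gt_eqF// cos_gt0_pihalf//; apply/andP; move: th => /andP[? ?]; split; lra.
have cs : cos (theta / 2) ^+ 2 + sin (theta / 2) ^+ 2 = 1 by exact: cos2Dsin2.
have thE : theta = theta / 2 + theta / 2 by field.
have sE : s = 2 * sin (theta / 2) * cos (theta / 2) by rewrite /s {1}thE sinD; ring.
have cE : cos theta = cos (theta / 2) ^+ 2 - sin (theta / 2) ^+ 2 by rewrite {1}thE cosD; ring.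
have cst : cos theta = 1 - s * t.
  rewrite cE sE /t /tan.
  have -> : 2 * sin (theta / 2) * cos (theta / 2) * (sin (theta / 2) / cos (theta / 2)) =
    2 * sin (theta / 2) ^+ 2 by field.
  by move: cs; lra.
have sst : s = 2 * t - t * t * s.
  rewrite sE /t /tan.
  have -> : 2 * (sin (theta / 2) / cos (theta / 2)) =
    2 * (sin (theta / 2) / cos (theta / 2)) * (cos (theta / 2) ^+ 2 + sin (theta / 2) ^+ 2).
    by rewrite cs mulr1.
  by field.
pose G1 x y := G (x + (- t) * y) y.
pose G2 x y := G1 x (y + s * x).
have cG1 : seq_cont2 G1 by exact: seq_cont2_shear.
have cG2 : seq_cont2 G2.
  have := seq_cont2_flip (@seq_cont2_shear (fun x y => G1 y x) s (seq_cont2_flip cG1)).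
  exact: id.
have cG3 : seq_cont2 (fun x y => G2 (x + (- t) * y) y) by exact: seq_cont2_shear.
transitivity (\int[mu]_x \int[mu]_y (G2 (x + (- t) * y)%R y)%:E)%E.
  apply: eq_integral => x _; apply: eq_integral => y _.
  rewrite /G2 /G1; congr (G _ _)%:E; rewrite -/s cst; last by ring.
  have -> : s * y = (2 * t - t * t * s) * y by rewrite -sst.
  by ring.
have G20 x y : 0 <= G2 x y by exact: G0.
have G10 x y : 0 <= G1 x y by exact: G0.
apply: (etrans (@swap_cont2 (fun x y => G2 (x + (- t) * y) y) _ cG3)) => //.
apply: (etrans (integral_shear_inner (- t) G20 cG2)).
apply: (etrans (esym (swap_cont2 G20 cG2))).
apply: (etrans (integral_shear_inner s (fun y x => G10 x y) (seq_cont2_flip cG1))).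
apply: (etrans (swap_cont2 G10 cG1)).
apply: (etrans (integral_shear_inner (- t) G0 cG)).
exact: esym (swap_cont2 G0 cG).
Qed.

End GaussianSubmean.

Section GaussianSubmean1.
Variable R : realType.
Local Notation mu := (@lebesgue_measure R).
Implicit Types h : R[i] -> R[i].

Definition fock_density h (x y : R) :=
  cabs2 (h (x +i* y)) * expR (- pi * (x ^+ 2 + y ^+ 2)).

Lemma fock_density_ge0 h x y : 0 <= fock_density h x y.
Proof. by rewrite mulr_ge0 ?cabs2_ge0 ?expR_ge0. Qed.

Lemma seq_cont2_fock_density h : cdiff h -> seq_cont2 (fock_density h).
Proof.
move=> dh x y a b xa yb; have [re im] := cdiff_cvg dh xa yb.
apply: cvgM; first by apply: cvgD; apply: cvgM.
apply: (continuous_cvg _ (@continuous_expR R _)).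
apply: cvgM; first exact: cvg_cst.
by apply: cvgD; apply: cvgM.
Qed.

Lemma gauss_plane : (\int[mu]_x \int[mu]_y (expR (- pi * (x ^+ 2 + y ^+ 2)))%:E = 1)%E.
Proof.
have g1 : (\int[mu]_x (expR (- pi * x ^+ 2))%:E = 1)%E.
  have := @gauss_int R pi 0 (pi_gt0 R); rewrite divff ?gt_eqF ?pi_gt0// sqrtr1 => <-.
  by apply: eq_integral => x _; rewrite subr0.
transitivity (\int[mu]_x (expR (- pi * x ^+ 2))%:E)%E => //.
apply: eq_integral => x _.
transitivity (\int[mu]_y ((expR (- pi * x ^+ 2))%:E * (expR (- pi * y ^+ 2))%:E))%E.
  by apply: eq_integral => y _; rewrite -EFinM -expRD -mulrDr.
rewrite ge0_integralZl ?lee_fin ?expR_ge0 ?g1 ?mule1//.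
apply/measurable_EFinP; apply: measurableT_comp => //; apply: measurable_funM => //.
Qed.

Definition rot_density h (t x y : R) :=
  cabs2 (h ((x +i* y) * cexp (0 +i* t))) * expR (- pi * (x ^+ 2 + y ^+ 2)).

Lemma rot_densityE h t x y : rot_density h t x y =
  fock_density h (cos t * x - sin t * y) (sin t * x + cos t * y).
Proof.
rewrite /rot_density /fock_density; congr (cabs2 (h _) * expR (_ * _)).
  apply/eqP; rewrite eq_complex ReM ImM /= expR0.
  by apply/andP; split; apply/eqP; ring.
have := cos2Dsin2 t; set c := cos t; set s := sin t => cs.
have -> : (c * x - s * y) ^+ 2 + (s * x + c * y) ^+ 2 =
   (c ^+ 2 + s ^+ 2) * (x ^+ 2 + y ^+ 2) by ring.
by rewrite cs mul1r.
Qed.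

Lemma cvg_rot_density h (t x y : R^nat) (c a b : R) : cdiff h ->
  t @ \oo --> c -> x @ \oo --> a -> y @ \oo --> b ->
  (fun k => rot_density h (t k) (x k) (y k)) @ \oo --> rot_density h c a b.
Proof.
move=> dh tc xa yb.
have ct : (fun k => cos (t k)) @ \oo --> cos c.
  by apply: (continuous_cvg _ (@continuous_cos R _)).
have st : (fun k => sin (t k)) @ \oo --> sin c.
  by apply: (continuous_cvg _ (@continuous_sin R _)).
rewrite rot_densityE; have -> : (fun k => rot_density h (t k) (x k) (y k)) = (fun k =>
    fock_density h (cos (t k) * x k - sin (t k) * y k) (sin (t k) * x k + cos (t k) * y k)).
  by apply/funext => k; rewrite rot_densityE.
by apply: (seq_cont2_fock_density dh); [apply: cvgB|apply: cvgD]; apply: cvgM.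
Qed.

Lemma continuous_rot_density h x y : cdiff h -> continuous (fun t => rot_density h t x y).
Proof.
move=> dh; apply: seq_continuous => t a ta.
by apply: (@cvg_rot_density h t (fun=> x) (fun=> y)) => //; exact: cvg_cst.
Qed.

(* The open arc keeps the indicator lower semicontinuous. *)
Definition arc_density h (t x y : R) :=
  if (- pi < t) && (t < pi) then rot_density h t x y else 0.

Lemma arc_density_ge0 h t x y : 0 <= arc_density h t x y.
Proof.
by rewrite /arc_density; case: ifP => // _; rewrite mulr_ge0 ?cabs2_ge0 ?expR_ge0.
Qed.

Lemma arc_density_lsc h (t x y : R^nat) (c a b : R) : cdiff h ->
  t @ \oo --> c -> x @ \oo --> a -> y @ \oo --> b ->
  ((arc_density h c a b)%:E <= limn_einf (fun k => (arc_density h (t k) (x k) (y k))%:E))%E.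
Proof.
move=> dh tc xa yb; rewrite {1}/arc_density; case: ifPn => [/andP[c1 c2]|_]; last first.
  apply: (@le_trans _ _ (limn_einf (fun _ : nat => 0%:E : \bar R))).
    have /cvg_limn_einf_sup[-> //] : (fun _ : nat => 0%:E : \bar R) @ \oo --> 0%:E.
    exact: cvg_cst.
  by apply: le_limn_einf => k; rewrite lee_fin arc_density_ge0.
suff /cvg_limn_einf_sup[-> //] :
  (fun k => (arc_density h (t k) (x k) (y k))%:E) @ \oo --> (rot_density h c a b)%:E.
apply: cvg_EFin; first exact: nearW.
apply: cvg_trans (cvg_rot_density dh tc xa yb); apply: near_eq_cvg.
near=> k; rewrite /= /arc_density ifT//; apply/andP; split; near: k.
  exact: (cvgr_gt c).
exact: (cvgr_lt c).
Unshelve. all: end_near. Qed.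

Lemma arc_density_total h : cdiff h ->
  (\int[mu]_t \int[mu]_x \int[mu]_y (arc_density h t x y)%:E =
   (\int[mu]_x \int[mu]_y (fock_density h x y)%:E) * (2 * pi)%:E)%E.
Proof.
move=> dh; set I := (\int[mu]_x \int[mu]_y (fock_density _ _ _)%:E)%E.
have pipi : - pi < pi :> R by rewrite gt0_cp ?pi_gt0.
pose D : set R := [set` `]- pi, pi[].
transitivity (\int[mu]_(t in D) (cst I) t)%E.
  rewrite [RHS]integral_mkcond; apply: eq_integral => t _.
  rewrite patchE /D mem_setE in_itv /= /arc_density; case: ifP => [th|_]; last first.
    by rewrite !integral0_eq// => x _; rewrite integral0_eq.
  apply: etrans (integral_rotation th (@fock_density_ge0 h) (seq_cont2_fock_density dh)).
  by apply: eq_integral => x _; apply: eq_integral => y _; rewrite rot_densityE.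
have mD : measurable D by exact: measurable_itv.
rewrite integral_cst//.
have := lebesgue_measure_itv (Interval (BRight (- pi)) (BLeft (pi : R))).
rewrite /= lte_fin pipi => ->; congr (I * _%:E)%E; ring.
Qed.

Lemma arc_density_swap h : cdiff h ->
  (\int[mu]_t \int[mu]_x \int[mu]_y (arc_density h t x y)%:E =
   \int[mu]_x \int[mu]_y \int[mu]_t (arc_density h t x y)%:E)%E.
Proof.
move=> dh; pose F (s : seq R) := (arc_density h (nth 0%R s 0) (nth 0%R s 1) (nth 0%R s 2))%:E.
have F0 s : (0 <= F s)%E by rewrite lee_fin arc_density_ge0.
have lF : lscn 3 F by move=> u s _ _ us; apply: arc_density_lsc => //; exact: us.
apply: (etrans (@swap_lsc2 R (fun t x => \int[mu]_y (arc_density h t x y)%:E)%E _ _)).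
- by move=> t x; apply: integral_ge0 => y _; rewrite lee_fin arc_density_ge0.
- move=> t x c a tc xa.
  apply: (lscn_integral F0 lF (u := fun k => [:: t k; x k]) (s := [:: c; a])) => //.
  by move=> [|[|i]] //=; rewrite !nth_nil; exact: cvg_cst.
apply: eq_integral => x _; apply: (@swap_lsc2 R (fun t y => (arc_density h t x y)%:E)).
  by move=> t y; rewrite lee_fin arc_density_ge0.
move=> t y c b tc yb; apply: (@arc_density_lsc h t (fun=> x)) => //; exact: cvg_cst.
Qed.

(** The Gaussian factor is constant on the circle through x + i y, so this is the submean inequality
    on that circle multiplied by it. *)
Lemma arc_density_inner h x y : cdiff h ->
  ((cabs2 (h 0) * (2 * pi))%:E * (expR (- pi * (x ^+ 2 + y ^+ 2)))%:E <=
   \int[mu]_t (arc_density h t x y)%:E)%E.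
Proof.
move=> dh; pose f t := rot_density h t x y.
have fE : (fun t => (arc_density h t x y)%:E) = (EFin \o f) \_ [set` `]- pi, pi[].
  by apply/funext => t; rewrite patchE mem_setE in_itv /= /arc_density; case: ifP.
rewrite fE -integral_mkcond.
have cf : continuous f by exact: continuous_rot_density.
have mf D : measurable_fun D (EFin \o f).
  apply/measurable_EFinP; apply: measurable_funTS.
  exact: (continuous_measurable_fun cf).
rewrite (integral_itv_bndo_bndc (mf _)) (integral_itv_obnd_cbnd (mf _)).
have iof := continuous_integrable_itv (- pi) pi cf.
rewrite -[leRHS]fineK ?(integrable_fin_num _ iof)//.
rewrite -EFinM lee_fin; set e := expR _.
rewrite (_ : fine _ = \int[mu]_(t in `[- pi, pi]) f t)//.
have -> : \int[mu]_(t in `[- pi, pi]) f t =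
    e * \int[mu]_(t in `[- pi, pi]) cabs2 (h ((x +i* y) * cexp (0 +i* t))).
  rewrite -RintegralZl//; first by apply: eq_Rintegral => t _; rewrite /f mulrC.
  have -> : EFin \o (fun t => cabs2 (h ((x +i* y) * cexp (0 +i* t)))) =
    EFin \o (fun t => f t * e^-1).
    by apply/funext => t /=; rewrite /f mulfK// gt_eqF ?expR_gt0.
  apply: continuous_integrable_itv => t; apply: cvgM; [exact: cf|exact: cvg_cst].
by rewrite mulrC ler_pM2l ?expR_gt0//; exact: circle_submean.
Qed.

(** The integral of [arc_density] over angle and plane is evaluated in both orders. Rotation
    invariance gives 2 pi times the right-hand side; the circle inequality gives at least 2 pi
    |h(0)|^2 times the Gaussian integral, which is 1. This plays the role of polar coordinates and
    gives the sharp constant. *)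
Lemma fock_submean0 h : cdiff h ->
  ((cabs2 (h 0))%:E <= \int[mu]_x \int[mu]_y (fock_density h x y)%:E)%E.
Proof.
move=> dh.
have pi20 : 0 < 2 * pi :> R by rewrite mulr_gt0 ?pi_gt0.
have cancel (J : \bar R) : ((cabs2 (h 0) * (2 * pi))%:E <= J * (2 * pi)%:E)%E ->
    ((cabs2 (h 0))%:E <= J)%E by rewrite EFinM lee_pmul2r// lte_fin.
apply: cancel; rewrite -arc_density_total// arc_density_swap//.
have ce0 : 0 <= cabs2 (h 0) * (2 * pi) by rewrite mulr_ge0 ?cabs2_ge0// ltW.
have inner x y := arc_density_inner x y dh.
move: ce0 inner; set c := cabs2 (h 0) * _ => ce0 inner.
have -> : (c%:E = c%:E * \int[mu]_x \int[mu]_y (expR (- pi * (x ^+ 2 + y ^+ 2)))%:E)%E.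
  by rewrite gauss_plane mule1.
pose E (s : seq R) := (expR (- pi * (nth 0 s 0 ^+ 2 + nth 0 s 1 ^+ 2)))%:E.
have lE : lscn 2 E.
  apply: lscn_continuous => u s us; apply: (continuous_cvg _ (@continuous_expR R _)).
  apply: cvgM; first exact: cvg_cst.
  by apply: cvgD; apply: cvgM.
have E0 s : (0 <= E s)%E by rewrite lee_fin expR_ge0.
have := @iter_intZ R 0 2 E [::] c erefl ce0 E0 lE.
rewrite /E /= => <-.
apply: ge0_le_integral_nonmeas => x.
  by apply: integral_ge0 => y _; rewrite mule_ge0 ?lee_fin ?expR_ge0.
apply: ge0_le_integral_nonmeas => y; first by rewrite mule_ge0 ?lee_fin ?expR_ge0.
exact: inner.
Qed.

(* Translation by w, followed by multiplication by a Gaussian holomorphic factor. *)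
Lemma fock_submean1 h w : cdiff h ->
  ((cabs2 (h w) * expR (- pi * cabs2 w))%:E <=
   \int[mu]_x \int[mu]_y (fock_density h x y)%:E)%E.
Proof.
move=> dh.
(* The exponential is chosen so that |H(z)|^2 exp(- pi |z|^2) = |h(z + w)|^2 exp(- pi |z + w|^2). *)
pose H z := h (1 * z + w) * cexp (- (pi%:C * (conjc w)) * z + (- (pi / 2) * cabs2 w)%:C).
have dH : cdiff H.
  apply: cdiffM; first exact: (cdiff_comp dh (cdiff_lin 1 w)).
  exact: (cdiff_comp (@cdiff_cexp R) (cdiff_lin _ _)).
have := fock_submean0 dH.
have -> : cabs2 (H 0) = cabs2 (h w) * expR (- pi * cabs2 w).
  rewrite /H !mulr0 !add0r cabs2M cabs2_cexp /=; congr (_ * expR _); by field.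
move=> H0; apply: le_trans H0 _.
have <- := @integral_translate2 R (fock_density h) (complex.Re w) (complex.Im w)
  (fock_density_ge0 h) (seq_cont2_fock_density dh).
rewrite le_eqVlt; apply/orP; left; apply/eqP.
apply: eq_integral => x _; apply: eq_integral => y _; congr _%:E.
rewrite /fock_density /H cabs2M cabs2_cexp mul1r -mulrA -expRD.
congr (cabs2 (h _) * expR _); first by case: (w) => a b.
by case: (w) => a b; rewrite /cabs2 /=; field.
Qed.
End GaussianSubmean1.

Lemma cvgn_sum (R : realType) (I : Type) (r : seq I) (f : I -> R^nat) (l : I -> R) :
  (forall i, f i @ \oo --> l i) ->
  (fun k => \sum_(i <- r) f i k) @ \oo --> \sum_(i <- r) l i.
Proof.
move=> fl; elim: r => [|i r IH].
  by rewrite big_nil; under eq_fun do rewrite big_nil; exact: cvg_cst.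
by rewrite big_cons; under eq_fun do rewrite big_cons; exact: cvgD.
Qed.

(** * Entire functions and the Fock norm on C^d *)

Section SeveralVariables.
Variables (R : realType) (d : nat).
Local Notation mu := (@lebesgue_measure R).
Local Notation C := R[i].
Implicit Types (F G : 'rV[C]_d -> C) (z w u : 'rV[C]_d).

Lemma vnorm2_ge0 z : 0 <= vnorm2 z.
Proof. by apply: sumr_ge0 => k _; exact: cabs2_ge0. Qed.

Lemma cabs2_le_vnorm2 z j : cabs2 (z 0 j) <= vnorm2 z.
Proof.
by rewrite /vnorm2 (bigD1 j)//= lerDl sumr_ge0// => k _; exact: cabs2_ge0.
Qed.

Lemma cabs_le_vnorm z j : cabs (z 0 j) <= vnorm z.
Proof. by rewrite ler_wsqrtr// cabs2_le_vnorm2. Qed.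

Lemma vnorm_lt z (e : R) : 0 < e -> (vnorm z < e) = (vnorm2 z < e ^+ 2).
Proof.
move=> e0; rewrite /vnorm -[in LHS](ger0_norm (ltW e0)) -sqrtr_sqr.
by rewrite ltr_sqrt// exprn_gt0.
Qed.

Lemma coord_vecE (j : 'I_d) (h : C) k : coord_vec j h 0 k = if k == j then h else 0.
Proof. by rewrite mxE. Qed.

Lemma coord_vecD (j : 'I_d) (h h' : C) : coord_vec j (h + h') = coord_vec j h + coord_vec j h'.
Proof.
by apply/rowP => k; rewrite !mxE; case: ifP => _; rewrite ?addr0.
Qed.

Lemma coord_vec0 (j : 'I_d) : coord_vec j (0 : C) = 0.
Proof. by apply/rowP => k; rewrite !mxE; case: ifP. Qed.

Lemma partial_holoP F z j :
  partial_holo F z j <-> exists L, cderiv (fun h => F (z + coord_vec j h)) 0 L.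
Proof.
split=> -[L HL]; exists L => e e0.
  have [dl dl0 Hd] := HL _ e0; exists dl => // h hd.
  rewrite add0r coord_vec0 addr0; have [->|h0] := eqVneq h 0.
    by rewrite coord_vec0 addr0 subrr mulr0 subr0 cabs0 mulr0.
  have -> : F (z + coord_vec j h) - F z - L * h =
    ((F (z + coord_vec j h) - F z) / h - L) * h by rewrite mulrBl mulfVK.
  by rewrite cabsM ler_wpM2r ?cabs_ge0// ltW// Hd.
have e20 : 0 < e / 2 by rewrite divr_gt0.
have [dl dl0 Hd] := HL _ e20; exists dl => // h h0 hd.
have := Hd _ hd; rewrite add0r coord_vec0 addr0 => H.
have -> : (F (z + coord_vec j h) - F z) / h - L =
  (F (z + coord_vec j h) - F z - L * h) / h by rewrite [RHS]mulrBl mulfK.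
have ch : 0 < cabs h by rewrite cabs_gt0.
rewrite cabsM cabsV ltr_pdivrMr// (le_lt_trans H)// ltr_pM2r//; lra.
Qed.

Lemma entire_slice F z j : entire F -> cdiff (fun t => F (z + coord_vec j t)).
Proof.
move=> [_ H] t; have /partial_holoP[L HL] := H (z + coord_vec j t) j.
exists L => e e0; have [dl dl0 Hd] := HL _ e0; exists dl => // h /Hd.
by rewrite add0r coord_vec0 addr0 coord_vecD addrA.
Qed.

Lemma entireD F G : entire F -> entire G -> entire (fun z => F z + G z).
Proof.
move=> [cF hF] [cG hG]; split=> [z e e0|z j]; last first.
  have /partial_holoP[L HL] := hF z j; have /partial_holoP[M HM] := hG z j.
  by apply/partial_holoP; exists (L + M); exact: cderivD.
have e20 : 0 < e / 2 by rewrite divr_gt0.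
have [d1 d10 H1] := cF z _ e20; have [d2 d20 H2] := cG z _ e20.
exists (Num.min d1 d2); first by rewrite lt_min d10.
move=> w; rewrite lt_min => /andP[/H1 h1 /H2 h2].
have -> : F w + G w - (F z + G z) = (F w - F z) + (G w - G z) by ring.
by rewrite (le_lt_trans (cabsD _ _))//; lra.
Qed.

Lemma entire_comp (f : C -> C) F : cdiff f -> entire F -> entire (f \o F).
Proof.
move=> df [cF hF]; split=> [z e e0|z j]; last first.
  have /partial_holoP[L HL] := hF z j.
  have [M HM] := df (F (z + coord_vec j 0)).
  by apply/partial_holoP; exists (M * L); exact: (cderiv_comp HL HM).
have [d1 d10 H1] := cdiff_continuous (F z) df e0.
have [d2 d20 H2] := cF z _ d10; exists d2 => // w /H2 /H1 /=.
by rewrite [F z + _]addrC subrK.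
Qed.

Lemma entire_cst (c : C) : entire (fun _ : 'rV[C]_d => c).
Proof.
split=> [z e e0|z j]; first by exists 1 => // w _; rewrite subrr cabs0.
by apply/partial_holoP; exists 0; exact: cderiv_cst.
Qed.

Lemma entire_coord j : entire (fun z : 'rV[C]_d => z 0 j).
Proof.
split=> [z e e0|z k].
  exists e => // w /(le_lt_trans _); apply.
  by have := cabs_le_vnorm (w - z) j; rewrite !mxE.
apply/partial_holoP; have [->|jk] := eqVneq j k.
  exists 1; have := cderiv_lin 1 (z 0 k) 0.
  rewrite (_ : (fun _ => _) = (fun h => (z + coord_vec k h) 0 k))//.
  by apply/funext => h; rewrite !mxE eqxx mul1r addrC.
exists 0; have := cderiv_cst 0 (z 0 j).
rewrite (_ : (fun _ => _) = (fun h => (z + coord_vec k h) 0 j))//.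
by apply/funext => h; rewrite !mxE (negPf jk) addr0.
Qed.

Lemma entireZ (c : C) F : entire F -> entire (fun z => c * F z).
Proof.
move=> eF; have := entire_comp (cdiff_lin c 0) eF.
by rewrite (_ : _ \o _ = (fun z => c * F z))//; apply/funext => z /=; rewrite addr0.
Qed.

Lemma entireM F G : entire F -> entire G -> entire (fun z => F z * G z).
Proof.
move=> eF eG.
have sq : cdiff (fun t : C => t * t) by move=> t; eexists; exact: cderiv_sqr.
have h1 := entire_comp sq (entireD (entireZ 2^-1 eF) (entireZ 2^-1 eG)).
have h2 := entire_comp sq (entireD (entireZ 2^-1 eF) (entireZ (- 2^-1) eG)).
have := entireD h1 (entireZ (-1) h2).
rewrite (_ : (fun _ => _) = (fun z => F z * G z))//.
by apply/funext => z /=; field.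
Qed.

Lemma entire_sum (I : Type) (r : seq I) (H : I -> 'rV[C]_d -> C) :
  (forall i, entire (H i)) -> entire (fun z => \sum_(i <- r) H i z).
Proof.
move=> eH; elim: r => [|i r IH].
  by under eq_fun do rewrite big_nil; exact: entire_cst.
by under eq_fun do rewrite big_cons; exact: entireD.
Qed.

Definition seq_contCd (f : 'rV[C]_d -> R) := forall (v : nat -> seq R) s,
  (forall i, (fun k => nth 0 (v k) i) @ \oo --> nth 0 s i) ->
  (fun k => f (to_Cd d (v k))) @ \oo --> f (to_Cd d s).

Lemma seq_contCd_vnorm2 : seq_contCd (@vnorm2 R d).
Proof.
move=> v s vs; rewrite /vnorm2; apply: cvgn_sum => k /=.
rewrite mxE /cabs2 /=.
have -> : (fun i => cabs2 (to_Cd d (v i) 0 k)) = (fun i =>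
    nth 0 (v i) (2 * k) ^+ 2 + nth 0 (v i) (2 * k + 1) ^+ 2).
  by apply/funext => i; rewrite mxE.
by apply: cvgD; apply: cvgM; exact: vs.
Qed.

Lemma seq_contCd_cabs2 F : continuousCd F -> seq_contCd (fun z => cabs2 (F z)).
Proof.
move=> cF v s vs.
suff H (e : R) : 0 < e -> \forall k \near \oo,
    cabs (F (to_Cd d (v k)) - F (to_Cd d s)) < e.
  apply: cvgD; apply: cvgM; apply/cvgrPdist_lt => e /H; apply: filterS => k;
    rewrite cabsBC; apply: le_lt_trans; rewrite -?ReN -?ReD ?normRe_cabs//;
    by rewrite -ImN -ImD normIm_cabs.
move=> /(cF (to_Cd d s))[dl dl0 Hd].
have : (fun k => vnorm2 (to_Cd d (v k) - to_Cd d s)) @ \oo --> (0 : R).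
  have -> : (0 : R) = \sum_(j < d) 0 by rewrite big1.
  apply: cvgn_sum => j /=.
  have -> : (fun i => cabs2 ((to_Cd d (v i) - to_Cd d s) 0 j)) = (fun i =>
      (nth 0 (v i) (2 * j) - nth 0 s (2 * j)) ^+ 2 +
      (nth 0 (v i) (2 * j + 1) - nth 0 s (2 * j + 1)) ^+ 2).
    by apply/funext => i; rewrite !mxE.
  have H i : (fun k => (nth 0 (v k) i - nth 0 s i) ^+ 2) @ \oo --> (0 : R).
    have h : (fun k => nth 0 (v k) i - nth 0 s i) @ \oo --> (0 : R).
      by rewrite -[X in _ --> X](subrr (nth 0 s i)); apply: cvgB; [exact: vs|exact: cvg_cst].
    by have := cvgM h h; rewrite mulr0; exact.
  by have := cvgD (H (2 * j)%N) (H (2 * j + 1)%N); rewrite addr0; exact.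
have dl2 : 0 < dl ^+ 2 by rewrite exprn_gt0.
move/cvgrPdist_lt => /(_ _ dl2); apply: filterS => k.
by rewrite sub0r normrN ger0_norm ?vnorm2_ge0// => h; apply: Hd; rewrite vnorm_lt.
Qed.

Lemma seq_contCd_lsc (f : 'rV[C]_d -> R) n : seq_contCd f ->
  lscn n (fun s => (f (to_Cd d s) * expR (- pi * vnorm2 (to_Cd d s)))%:E).
Proof.
move=> cf; apply: lscn_continuous => v s vs; apply: cvgM; first exact: cf.
apply: (continuous_cvg _ (@continuous_expR R _)).
apply: cvgM; [exact: cvg_cst|exact: seq_contCd_vnorm2].
Qed.

Definition gauss_integral_Cd (f : 'rV[C]_d -> R) : \bar R :=
  integral_Cd (fun z => (f z * expR (- pi * vnorm2 z))%:E).

Lemma gauss_integralD f g : (forall z, 0 <= f z) -> (forall z, 0 <= g z) ->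
  seq_contCd f -> seq_contCd g ->
  (gauss_integral_Cd (fun z => f z + g z)%R =
   gauss_integral_Cd f + gauss_integral_Cd g)%E.
Proof.
move=> f0 g0 cf cg.
pose W (h : 'rV[C]_d -> R) (s : seq R) := (h (to_Cd d s) * expR (- pi * vnorm2 (to_Cd d s)))%:E.
have W0 (h : 'rV[C]_d -> R) : (forall z, 0 <= h z) -> forall s, (0 <= W h s)%E.
  by move=> h0 s; rewrite lee_fin mulr_ge0 ?expR_ge0.
have := @iter_intD R 0 (2 * d)%N (W f) (W g) [::] erefl (W0 _ f0) (W0 _ g0)
  (@seq_contCd_lsc f _ cf) (@seq_contCd_lsc g _ cg).
move=> <-; congr iter_int; apply/funext => s.
by rewrite /W -EFinD mulrDl.
Qed.

Lemma gauss_integralZ (c : R) f : 0 <= c -> (forall z, 0 <= f z) -> seq_contCd f ->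
  (gauss_integral_Cd (fun z => c * f z)%R = c%:E * gauss_integral_Cd f)%E.
Proof.
move=> c0 f0 cf; pose W (s : seq R) := (f (to_Cd d s) * expR (- pi * vnorm2 (to_Cd d s)))%:E.
have W0 s : (0 <= W s)%E by rewrite lee_fin mulr_ge0 ?expR_ge0.
have := @iter_intZ R 0 (2 * d)%N W [::] c erefl c0 W0 (@seq_contCd_lsc f _ cf).
move=> <-; congr iter_int; apply/funext => s.
by rewrite /W -EFinM mulrA.
Qed.

Definition gweight F z := cabs2 (F z) * expR (- pi * vnorm2 z).

Lemma vnorm2_coordD u j t : u 0 j = 0 ->
  vnorm2 (u + coord_vec j t) = vnorm2 u + cabs2 t.
Proof.
move=> uj; rewrite /vnorm2 (bigD1 j)//= [in RHS](bigD1 j)//= uj cabs2_0 add0r.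
rewrite mxE coord_vecE eqxx uj add0r addrC; congr (_ + _).
by apply: eq_bigr => k kj; rewrite mxE coord_vecE (negPf kj) addr0.
Qed.

Lemma gweight_submean F u j t : entire F -> u 0 j = 0 ->
  ((gweight F (u + coord_vec j t))%:E <=
   \int[mu]_x \int[mu]_y (gweight F (u + coord_vec j (x +i* y)))%:E)%E.
Proof.
move=> eF uj.
pose h s := (expR (- pi * vnorm2 u / 2))%:C * F (u + coord_vec j s).
have dh : cdiff h by apply: cdiffM; [exact: cdiff_cst|exact: entire_slice].
have E s : gweight F (u + coord_vec j s) = cabs2 (h s) * expR (- pi * cabs2 s).
  rewrite /gweight /h cabs2M cabs2_real expr2 -expRD vnorm2_coordD//.
  have -> : - pi * vnorm2 u / 2 + - pi * vnorm2 u / 2 = - pi * vnorm2 u by field.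
  by rewrite mulrDr expRD mulrA [cabs2 _ * _]mulrC.
rewrite E; apply: le_trans (fock_submean1 t dh) _.
rewrite le_eqVlt; apply/orP; left; apply/eqP.
by apply: eq_integral => x _; apply: eq_integral => y _; rewrite E.
Qed.

(** Passes from w, at p = 0, to the point encoded by [pre], at p = d, as coordinates become
    integration variables. *)
Definition mix (p : nat) (pre : seq R) w : 'rV[C]_d :=
  \row_k (if (k < p)%N then to_Cd d pre 0 k else w 0 k).

(** The planar inequality is applied one complex coordinate at a time, each accounting for two of
    the nested real integrals. *)
Lemma gweight_submean_iter F w m p pre : entire F -> (p + m)%N = d ->
  size pre = (2 * p)%N ->
  ((gweight F (mix p pre w))%:E <=
   iter_int (2 * m) (fun s => (gweight F (to_Cd d (pre ++ s)))%:E))%E.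
Proof.
move=> eF; elim: m p pre => [|m IH] p pre pd sp.
  rewrite muln0 /= cats0; suff -> : mix p pre w = to_Cd d pre by [].
  by apply/rowP => k; rewrite mxE (_ : p = d) ?ltn_ord// -pd addn0.
have pltd : (p < d)%N by rewrite -pd -[ltnLHS]addn0 ltn_add2l.
pose j := Ordinal pltd.
pose u : 'rV[C]_d := \row_k (if k == j then 0 else mix p pre w 0 k).
have uj : u 0 j = 0 by rewrite mxE eqxx.
have -> : mix p pre w = u + coord_vec j (w 0 j).
  apply/rowP => k; rewrite !mxE; case: eqVneq => [->|_]; last by rewrite addr0.
  by rewrite /= ltnn add0r.
apply: le_trans (gweight_submean _ eF uj) _.
rewrite (_ : (2 * m.+1)%N = (2 * m).+2); last by rewrite mulnS.
rewrite [leRHS]/=; apply: ge0_le_integral_nonmeas => x.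
  by apply: integral_ge0 => y _; rewrite lee_fin mulr_ge0 ?cabs2_ge0 ?expR_ge0.
apply: ge0_le_integral_nonmeas => y.
  by rewrite lee_fin mulr_ge0 ?cabs2_ge0 ?expR_ge0.
have -> : (fun s => (gweight F (to_Cd d (pre ++ x :: y :: s)))%:E) =
    (fun s => (gweight F (to_Cd d ((pre ++ [:: x; y]) ++ s)))%:E).
  by apply/funext => s; rewrite -catA.
have := IH p.+1 (pre ++ [:: x; y]).
rewrite addSnnS size_cat sp /= => /(_ pd); rewrite addn2 mulnS => /(_ erefl).
suff -> : mix p.+1 (pre ++ [:: x; y]) w = u + coord_vec j (x +i* y) by [].
apply/rowP => k; rewrite !mxE; case: eqVneq => [->|kj] /=.
  rewrite leqnn add0r !nth_cat sp ltnn subnn /= ltnNge leq_addr /=.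
  by rewrite addKn.
have kp : nat_of_ord k != p by [].
rewrite addr0 ltnS leq_eqVlt (negPf kp) /=; case: ifP => // kp'.
have k2 : (2 * k + 1 < 2 * p)%N by rewrite addn1 -addn2 -[(2 * k + 2)%N]mulnSr leq_mul2l.
by rewrite !nth_cat sp k2 (leq_ltn_trans _ k2) ?leq_addr.
Qed.

(** The constant 1 is attained by the normalized kernel at w; the first-variation argument for the
    reproducing formula rests on this sharpness. *)
Lemma gweight_le_fock F w : entire F -> ((gweight F w)%:E <= fock_norm2 F)%E.
Proof.
move=> eF; have := @gweight_submean_iter F w d 0 [::] eF erefl erefl.
by rewrite (_ : mix 0 [::] w = w)//; apply/rowP => k; rewrite mxE.
Qed.

End SeveralVariables.

(** * Gaussian integrals over C^d and quadratic identities for the Fock norm *)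

Section GaussianProducts.
Variable R : realType.
Local Notation mu := (@lebesgue_measure R).

(** The free constant c lets the induction absorb the factor of the outermost variable. *)
Lemma iter_int_prod n (c : R) (f : nat -> R -> R) (I : nat -> R) : 0 <= c ->
  (forall i x, 0 <= f i x) -> (forall i, measurable_fun setT (f i)) ->
  (forall i, \int[mu]_x (f i x)%:E = (I i)%:E)%E ->
  iter_int n (fun s => (c * \prod_(i < n) f i (nth 0 s i))%:E) =
  (c * \prod_(i < n) I i)%:E.
Proof.
move=> + f0 mf fI; elim: n c f I f0 mf fI => [|n IH] c f I f0 mf fI c0.
  by rewrite /= !big_ord0.
rewrite /= big_ord_recl.
transitivity (\int[mu]_x ((c * \prod_(i < n) I i.+1)%:E * (f 0%N x)%:E))%E.
  apply: eq_integral => x _.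
  have := IH (c * f 0%N x) (fun i => f i.+1) (fun i => I i.+1)
    (fun i => f0 i.+1) (fun i => mf i.+1) (fun i => fI i.+1) (mulr_ge0 c0 (f0 _ _)).
  rewrite -EFinM (_ : c * (\prod_(i < n) I i.+1) * f 0%N x =
    c * f 0%N x * \prod_(i < n) I i.+1); last by ring.
  move=> <-; congr iter_int; apply/funext => s.
  by rewrite big_ord_recl /= mulrA.
rewrite ge0_integralZl//.
- by rewrite fI -EFinM -mulrA; congr (_ * _)%:E; rewrite mulrC.
- by apply/measurable_EFinP; exact: mf.
- by move=> x _; rewrite lee_fin.
- rewrite lee_fin mulr_ge0// prodr_ge0// => i _; rewrite -lee_fin -fI.
  by apply: integral_ge0 => x _; rewrite lee_fin.
Qed.

End GaussianProducts.

Section FockNorm.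
Variables (R : realType) (d : nat).
Local Notation mu := (@lebesgue_measure R).
Local Notation C := R[i].
Implicit Types (F G : 'rV[C]_d -> C) (z w u : 'rV[C]_d) (c : C).

Lemma big_pairs (A : nat -> R) n :
  \sum_(i < 2 * n) A i = \sum_(k < n) (A (2 * k)%N + A (2 * k + 1)%N).
Proof.
elim: n => [|n IH]; first by rewrite !big_ord0.
rewrite [RHS]big_ord_recr /= -IH (_ : (2 * n.+1)%N = (2 * n).+2).
  by rewrite !big_ord_recr /= addrA addn1.
by rewrite mulnSr addn2.
Qed.

Lemma integral_gauss (a : R) w : 0 < a ->
  integral_Cd (fun z => (expR (- a * vnorm2 (z - w)))%:E) = ((pi / a) ^+ d)%:E.
Proof.
(* [ctr] lists the real and imaginary parts of w alternately, matching the order of [to_Cd]; [wn]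
   extends the coordinates of w to all naturals by 0. *)
move=> a0; pose wn (k : nat) : C := if insub k is Some j then w 0 j else 0.
pose ctr (i : nat) : R := if odd i then complex.Im (wn i./2) else complex.Re (wn i./2).
pose f i x := expR (- a * (x - ctr i) ^+ 2).
have := @iter_int_prod R (2 * d)%N 1 f (fun=> Num.sqrt (pi / a)) ler01.
rewrite prodr_const card_ord exprM sqr_sqrtr ?mul1r; last first.
  by rewrite divr_ge0 ?pi_ge0// ltW.
move=> <-.
- congr iter_int; apply/funext => s; rewrite mul1r /f -expR_sum; congr (expR _)%:E.
  rewrite -mulr_sumr (big_pairs (fun i => (nth 0 s i - ctr i) ^+ 2)); congr (_ * _).
  apply: eq_bigr => k _; rewrite !mxE /cabs2 /ctr mul2n odd_double doubleK.
  rewrite addn1 /= odd_double /= uphalf_double /wn.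
  by case: insubP => [j _ /val_inj <-|]; [case: (w 0 j)|rewrite ltn_ord].
- by move=> i x; exact: expR_ge0.
- move=> i; apply: measurableT_comp => //; apply: measurable_funM => //.
  by apply: measurable_funX; exact: measurable_funB.
- by move=> i; exact: gauss_int.
Qed.

Lemma in_fock_gauss_bound F (K a : R) w : entire F -> 0 <= K -> 0 < a ->
  (forall z, gweight F z <= K * expR (- a * vnorm2 (z - w))) ->
  in_fock F /\ (fock_norm2 F <= (K * (pi / a) ^+ d)%:E)%E.
Proof.
move=> eF K0 a0 Fb; suff H : (fock_norm2 F <= (K * (pi / a) ^+ d)%:E)%E.
  by split=> //; split=> //; rewrite (le_lt_trans H)// ltry.
rewrite EFinM -(integral_gauss w a0).
pose W (s : seq R) := (expR (- a * vnorm2 (to_Cd d s - w)))%:E.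
have lW : lscn (2 * d) W.
  apply: lscn_continuous => v s vs; apply: (continuous_cvg _ (@continuous_expR R _)).
  apply: cvgM; first exact: cvg_cst.
  apply: cvgn_sum => j /=; rewrite /cabs2.
  have -> : (fun i => cabs2 ((to_Cd d (v i) - w) 0 j)) = (fun i =>
      (nth 0 (v i) (2 * j) - complex.Re (w 0 j)) ^+ 2 +
      (nth 0 (v i) (2 * j + 1) - complex.Im (w 0 j)) ^+ 2).
    by apply/funext => i; rewrite !mxE; case: (w 0 j).
  rewrite !mxE ReD ImD ReN ImN /=.
  by apply: cvgD; apply: cvgM; apply: cvgB; (exact: vs || exact: cvg_cst).
have W0 s : (0 <= W s)%E by rewrite lee_fin expR_ge0.
have := @iter_intZ R 0 (2 * d)%N W [::] K erefl K0 W0 lW.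
rewrite /integral_Cd => <-; apply: le_iter_int => s.
  by rewrite lee_fin mulr_ge0 ?cabs2_ge0 ?expR_ge0.
by rewrite -EFinM lee_fin; exact: Fb.
Qed.

Definition nF F : R := fine (fock_norm2 F).

Lemma fock_norm2E F : in_fock F -> fock_norm2 F = (nF F)%:E.
Proof.
move=> [_ Ff]; rewrite fineK// ge0_fin_numE// /fock_norm2 /integral_Cd.
by apply: iter_int_ge0 => s; rewrite lee_fin mulr_ge0 ?cabs2_ge0 ?expR_ge0.
Qed.

Lemma nF_ge0 F : 0 <= nF F.
Proof.
rewrite fine_ge0// iter_int_ge0// => s.
by rewrite lee_fin mulr_ge0 ?cabs2_ge0 ?expR_ge0.
Qed.

Lemma seq_contCd_scaled F (a : R) : entire F -> seq_contCd (fun z => a * cabs2 (F z)).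
Proof.
move=> eF v s vs; apply: cvgM; first exact: cvg_cst.
by have := seq_contCd_cabs2 eF.1; apply.
Qed.

(** Each quadratic identity for [nF] follows by writing one pointwise expression as two such
    combinations. Negative terms are moved to the other side, since additivity is available for
    nonnegative integrands. *)
Lemma gauss_integral_comb3 (a1 a2 a3 : R) F1 F2 F3 : 0 <= a1 -> 0 <= a2 -> 0 <= a3 ->
  in_fock F1 -> in_fock F2 -> in_fock F3 ->
  gauss_integral_Cd (fun z => a1 * cabs2 (F1 z) + (a2 * cabs2 (F2 z) + a3 * cabs2 (F3 z))) =
  (a1 * nF F1 + (a2 * nF F2 + a3 * nF F3))%:E.
Proof.
move=> a10 a20 a30 f1 f2 f3.
have p (a : R) F z : 0 <= a -> 0 <= a * cabs2 (F z) by move=> ?; rewrite mulr_ge0 ?cabs2_ge0.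
have one (a : R) F : 0 <= a -> in_fock F ->
    gauss_integral_Cd (fun z => a * cabs2 (F z)) = (a * nF F)%:E.
  move=> a0 fF; rewrite EFinM -(fock_norm2E fF).
  rewrite gauss_integralZ//; first by move=> z; exact: cabs2_ge0.
  exact: seq_contCd_cabs2 fF.1.1.
have c1 := @seq_contCd_scaled F1 a1 f1.1.
have c2 := @seq_contCd_scaled F2 a2 f2.1.
have c3 := @seq_contCd_scaled F3 a3 f3.1.
rewrite !gauss_integralD ?one ?EFinD//.
- by move=> z; exact: p.
- by move=> z; exact: p.
- by move=> z; exact: p.
- by move=> z; rewrite addr_ge0// p.
- by move=> v s vs; apply: cvgD; [exact: c2|exact: c3].
Qed.

Lemma le_gauss_integral (f g : 'rV[C]_d -> R) : (forall z, 0 <= f z) ->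
  (forall z, f z <= g z) -> (gauss_integral_Cd f <= gauss_integral_Cd g)%E.
Proof.
move=> f0 fg; apply: le_iter_int => s.
  by rewrite lee_fin mulr_ge0 ?expR_ge0.
by rewrite lee_fin ler_wpM2r ?expR_ge0.
Qed.

Lemma in_fockD F G : in_fock F -> in_fock G -> in_fock (fun z => F z + G z).
Proof.
move=> fF fG; split; first exact: entireD fF.1 fG.1.
have := @gauss_integral_comb3 2 2 0 F G F (ler0n _ 2) (ler0n _ 2) (lexx _) fF fG fF.
move=> E; apply: (@le_lt_trans _ _ (2 * nF F + (2 * nF G + 0 * nF F))%:E); last exact: ltry.
rewrite -E; apply: (@le_gauss_integral (fun z => cabs2 (F z + G z))) => z.
  exact: cabs2_ge0.
by rewrite mul0r addr0 cabs2D_le.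
Qed.

Lemma in_fockZ c F : in_fock F -> in_fock (fun z => c * F z).
Proof.
move=> fF; split; first exact: entireZ fF.1.
have := @gauss_integral_comb3 (cabs2 c) 0 0 F F F (cabs2_ge0 _) (lexx _) (lexx _) fF fF fF.
set r := _%:E => E; apply: (@le_lt_trans _ _ r); last exact: ltry.
rewrite -E; apply: (@le_gauss_integral (fun z => cabs2 (c * F z))) => z.
  exact: cabs2_ge0.
by rewrite !mul0r !addr0 cabs2M.
Qed.

Lemma in_fock0 : in_fock (fun _ : 'rV[C]_d => 0).
Proof.
apply: (@in_fock_gauss_bound _ 0 1 0 (entire_cst _ _) (lexx _) ltr01 _).1 => z.
by rewrite mul0r /gweight cabs2_0 mul0r.
Qed.

Lemma nF_parallelogram F G : in_fock F -> in_fock G ->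
  nF (fun z => F z + G z) + nF (fun z => F z + (-1) * G z) = 2 * nF F + 2 * nF G.
Proof.
move=> fF fG; have fD := in_fockD fF fG; have fB := in_fockD fF (in_fockZ (-1) fG).
have := @gauss_integral_comb3 1 1 0 _ _ F ler01 ler01 (lexx _) fD fB fF.
have := @gauss_integral_comb3 2 2 0 _ _ F (ler0n _ 2) (ler0n _ 2) (lexx _) fF fG fF.
rewrite (_ : (fun z => 2 * _ + _) = (fun z => 1 * cabs2 (F z + G z) +
  (1 * cabs2 (F z + -1 * G z) + 0 * cabs2 (F z)))).
  by move=> -> [] ; rewrite !mul0r !addr0 !mul1r => ->.
apply/funext => z; case: (F z) (G z) => [a b] [a' b'].
by rewrite /cabs2 /=; ring.
Qed.

(** A substitute for sesquilinearity: the cross term 2 Re<F, G> appears as |F + G|^2 - |F|^2 - |G|^2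
    and is seen to scale linearly in t. With t >= 0 all coefficients stay nonnegative. *)
Lemma nF_affine F G (t : R) : 0 <= t -> in_fock F -> in_fock G ->
  nF (fun z => F z + t%:C * G z) + (t * nF F + t * nF G) =
  nF F + (t * nF (fun z => F z + G z) + t ^+ 2 * nF G).
Proof.
move=> t0 fF fG; have fD := in_fockD fF fG; have ft := in_fockD fF (in_fockZ t%:C fG).
have := @gauss_integral_comb3 1 t t _ _ _ ler01 t0 t0 ft fF fG.
have := @gauss_integral_comb3 1 t (t ^+ 2) _ _ _ ler01 t0 (sqr_ge0 _) fF fD fG.
rewrite (_ : (fun z => 1 * cabs2 (F z) + _) = (fun z => 1 * cabs2 (F z + t%:C * G z) +
  (t * cabs2 (F z) + t * cabs2 (G z)))).
  by move=> -> []; rewrite !mul1r => ->.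
apply/funext => z; case: (F z) (G z) => [a b] [a' b'].
by rewrite /cabs2 /=; ring.
Qed.

End FockNorm.

(** * Reproducing kernels *)

Section Kernels.
Variables (R : realType) (d : nat).
Local Notation C := R[i].
Implicit Types (F G : 'rV[C]_d -> C) (z w l m : 'rV[C]_d) (c : C).

Definition samp F w : C := F w * (expR (- pi * vnorm2 w / 2))%:C.

Lemma cabs2_samp F w : cabs2 (samp F w) = gweight F w.
Proof.
rewrite /samp cabs2M cabs2_real expr2 -expRD /gweight.
by congr (_ * expR _); field.
Qed.

Lemma sampD F G w : samp (fun z => F z + G z) w = samp F w + samp G w.
Proof. by rewrite /samp mulrDl. Qed.

Lemma sampZ c F w : samp (fun z => c * F z) w = c * samp F w.
Proof. by rewrite /samp mulrA. Qed.

Lemma cabs2_samp_le F w : in_fock F -> cabs2 (samp F w) <= nF F.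
Proof.
move=> fF; rewrite cabs2_samp -lee_fin -fock_norm2E//.
exact: gweight_le_fock fF.1.
Qed.

Definition herm z w : C := \sum_j z 0 j * (conjc (w 0 j)).

Lemma herm_conj z w : (conjc (herm z w)) = herm w z.
Proof.
rewrite /herm rmorph_sum; apply: eq_bigr => j _.
by rewrite rmorphM /= conjcK mulrC.
Qed.

Lemma herm_self z : herm z z = (vnorm2 z)%:C.
Proof.
rewrite /herm /vnorm2 rmorph_sum; apply: eq_bigr => j _.
by case: (z 0 j) => a b; apply/eqP; rewrite eq_complex /cabs2 /=; apply/andP; split;
  apply/eqP; ring.
Qed.

Lemma Re_sum (I : Type) (r : seq I) (f : I -> C) :
  complex.Re (\sum_(i <- r) f i) = \sum_(i <- r) complex.Re (f i).
Proof. by elim: r => [|i r IH]; rewrite ?big_nil// !big_cons ReD IH. Qed.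

Lemma vnorm2B z w : vnorm2 (z - w) = vnorm2 z + vnorm2 w - 2 * complex.Re (herm z w).
Proof.
rewrite /herm Re_sum /vnorm2 mulr_sumr -big_split /= -sumrB; apply: eq_bigr => j _.
by rewrite !mxE /cabs2 ReD ImD ReM ReN ImN Re_conj Im_conj; ring.
Qed.

Definition ker w z : C := cexp (pi%:C * herm z w + (- (pi / 2) * vnorm2 w)%:C).

Lemma entire_herm w : entire (fun z => herm z w).
Proof.
apply: entire_sum => j.
by have := entireZ ((conjc (w 0 j))) (entire_coord R j); under eq_fun do rewrite mulrC.
Qed.

Lemma entire_ker w : entire (ker w).
Proof.
apply: (entire_comp (@cdiff_cexp R)); apply: entireD; last exact: entire_cst.
by apply: entireZ; exact: entire_herm.
Qed.

Lemma gweight_ker w z : gweight (ker w) z = expR (- pi * vnorm2 (z - w)).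
Proof.
rewrite /gweight /ker cabs2_cexp -expRD vnorm2B ReD ReM /=; congr expR.
by field.
Qed.

Lemma fock_ker w : in_fock (ker w) /\ nF (ker w) <= 1.
Proof.
have H z : gweight (ker w) z <= 1 * expR (- pi * vnorm2 (z - w)).
  by rewrite gweight_ker mul1r.
have [f fle] := in_fock_gauss_bound (entire_ker w) ler01 (pi_gt0 R) H.
split=> //; rewrite -lee_fin -fock_norm2E// (le_trans fle)// lee_fin mul1r.
by rewrite divff ?expr1n// gt_eqF ?pi_gt0.
Qed.

Definition gam l m : C := samp (ker m) l.

Lemma gamE l m : gam l m = cexp (pi%:C * herm l m - (pi / 2 * (vnorm2 l + vnorm2 m))%:C).
Proof.
rewrite /gam /samp /ker -cexp_real -cexpD; congr cexp; rewrite -addrA; congr (_ + _).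
by rewrite -rmorphD -rmorphN; congr (_%:C); field.
Qed.

Lemma gam_self m : gam m m = 1.
Proof.
rewrite gamE herm_self -rmorphM -rmorphB /= (_ : _ - _ = 0) ?cexp0//.
by field.
Qed.

Lemma conjM (x y : C) : conjc (x * y) = conjc x * conjc y.
Proof.
by case: x y => [a b] [a' b']; apply/eqP; rewrite eq_complex /=; apply/andP; split;
  apply/eqP; ring.
Qed.

Lemma conjM_real (r : R) (z : C) : (conjc (r%:C * z)) = r%:C * (conjc z).
Proof. by case: z => a b; apply/eqP; rewrite eq_complex /= !mul0r !subr0 !addr0 mulrN !eqxx. Qed.

Lemma conjB_real (r : R) (z : C) : (conjc (z - r%:C)) = (conjc z) - r%:C.
Proof. by case: z => a b; apply/eqP; rewrite eq_complex /= oppr0 !addr0 !eqxx. Qed.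

Lemma gam_conj l m : gam m l = (conjc (gam l m)).
Proof.
rewrite !gamE -cexp_conj; congr cexp.
by rewrite conjB_real conjM_real herm_conj [vnorm2 l + _]addrC.
Qed.

Lemma cabs_gam l m : cabs (gam l m) = expR (- (pi / 2) * vnorm2 (l - m)).
Proof.
rewrite gamE cabs_cexp vnorm2B ReD ReN ReM /=; congr expR; by field.
Qed.

Lemma cabs2D (x y : C) :
  cabs2 (x + y) = cabs2 x + 2 * complex.Re (conjc y * x) + cabs2 y.
Proof. by case: x y => [a b] [a' b']; rewrite /cabs2 /=; ring. Qed.

Lemma nFZ c F : in_fock F -> nF (fun z => c * F z) = cabs2 c * nF F.
Proof.
move=> fF.
have := @gauss_integral_comb3 R d 1 0 0 _ F F ler01 (lexx _) (lexx _) (in_fockZ c fF) fF fF.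
have := @gauss_integral_comb3 R d (cabs2 c) 0 0 F F F (cabs2_ge0 _) (lexx _) (lexx _) fF fF fF.
rewrite (_ : (fun z => cabs2 c * _ + _) = (fun z => 1 * cabs2 (c * F z) +
  (0 * cabs2 (F z) + 0 * cabs2 (F z)))); last first.
  by apply/funext => z; rewrite cabs2M !mul0r mul1r.
by move=> -> []; rewrite !mul0r !addr0 mul1r.
Qed.

(* Expand the sharp pointwise bound along F + t c k_w and let t go to infinity. *)
Lemma nF_add_ker_ge F c w : in_fock F ->
  2 * complex.Re ((conjc c) * samp F w) <=
  nF (fun z => F z + c * ker w z) - nF F - nF (fun z => c * ker w z).
Proof.
move=> fF; have [fk k1] := fock_ker w; have fck := in_fockZ c fk.
set x := samp F w; set D := _ - _ - _; set r := complex.Re _; rewrite leNgt; apply/negP => Dr.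
have x_le : cabs2 x <= nF F by exact: cabs2_samp_le.
(* Both sides of the pointwise bound contain t^2 |c|^2, on the right because |k_w| <= 1; after
   cancellation only an inequality affine in t remains. *)
have key (t : R) : 0 <= t -> cabs2 x + 2 * (t * r) <= nF F + t * D.
  move=> t0; have := cabs2_samp_le w (in_fockD fF (in_fockZ t%:C fck)).
  rewrite sampD !sampZ -/x -/(gam w w) gam_self mulr1 cabs2D.
  have -> : complex.Re ((conjc (t%:C * c)) * x) = t * r.
    by rewrite conjM_real -mulrA ReM /= mul0r subr0.
  rewrite cabs2M cabs2_real.
  have := nF_affine t0 fF fck; rewrite /D.
  have : t ^+ 2 * nF (fun z => c * ker w z) <= t ^+ 2 * cabs2 c.
    by rewrite nFZ// ler_wpM2l ?sqr_ge0// ler_piMr ?cabs2_ge0.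
  move: (nF _) (nF _) (nF _) (nF _) (cabs2 c) (cabs2 x) => n1 n2 n3 n4 n5 n6.
  by lra.
have rD : 0 < 2 * r - D by rewrite subr_gt0.
(* At this t the affine inequality t (2 r - D) <= |F|^2 - |x|^2 fails by exactly 1. *)
have t0 : 0 <= (nF F - cabs2 x + 1) / (2 * r - D).
  by rewrite divr_ge0 ?(ltW rD)// addr_ge0// subr_ge0.
have := key _ t0; set t := _ / _ => kt.
have : t * (2 * r - D) = nF F - cabs2 x + 1 by rewrite /t mulfVK// gt_eqF.
move: kt; rewrite (mulrBr t (2 * r) D) [2 * (t * r)]mulrCA.
move: (nF F) (cabs2 x) (t * D) (t * (2 * r)) => n1 n2 n3 n4 k1' k2'.
lra.
Qed.

(** This is the reproducing formula in norm form. The one-sided bound is applied to c and to -c, and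
    the parallelogram law forces equality in both. *)
Lemma nF_add_ker F c w : in_fock F ->
  nF (fun z => F z + c * ker w z) = nF F + 2 * complex.Re ((conjc c) * samp F w) + cabs2 c.
Proof.
move=> fF; have [fk k1] := fock_ker w; have fck := in_fockZ c fk.
have kk : nF (ker w) = 1.
  apply/eqP; rewrite eq_le k1 /=; have := cabs2_samp_le w fk.
  by rewrite -/(gam w w) gam_self -sqr_cabs cabs1 expr1n.
have gk : nF (fun z => c * ker w z) = cabs2 c by rewrite nFZ// kk mulr1.
have h1 := nF_add_ker_ge c w fF; have h2 := nF_add_ker_ge (- c) w fF.
have h3 := nF_parallelogram fF fck.
have e1 : (fun z => - c * ker w z) = (fun z => (-1) * (c * ker w z)).
  by apply/funext => z; rewrite mulN1r mulNr.
have e2 : (fun z => F z + - c * ker w z) = (fun z => F z + (-1) * (c * ker w z)).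
  by apply/funext => z; rewrite mulN1r mulNr.
have e3 : nF (fun z => (-1) * (c * ker w z)) = cabs2 c.
  by rewrite nFZ// gk cabs2N -sqr_cabs cabs1 expr1n mul1r.
move: h1 h2 h3; rewrite e1 e2 e3 gk rmorphN mulNr ReN.
move: (nF _) (nF _) (nF _) (complex.Re _) (cabs2 c) => n1 n2 n3 r q h1 h2 h3.
lra.
Qed.

Definition kcomb (s : seq 'rV[C]_d) (b : 'rV[C]_d -> C) z := \sum_(m <- s) b m * ker m z.

Definition gform (s : seq 'rV[C]_d) (b : 'rV[C]_d -> C) : R :=
  complex.Re (\sum_(l <- s) (conjc (b l)) * \sum_(m <- s) gam l m * b m).

Lemma fock_kcomb s b : in_fock (kcomb s b).
Proof.
elim: s => [|m s IH].
  rewrite (_ : kcomb _ _ = fun=> 0); first exact: in_fock0.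
  by apply/funext => z; rewrite /kcomb big_nil.
rewrite (_ : kcomb _ _ = fun z => b m * ker m z + kcomb s b z).
  by apply: in_fockD => //; apply: in_fockZ; case: (fock_ker m).
by apply/funext => z; rewrite /kcomb big_cons.
Qed.

Lemma samp_kcomb s b l : samp (kcomb s b) l = \sum_(m <- s) gam l m * b m.
Proof.
rewrite /samp /kcomb mulr_suml; apply: eq_bigr => m _.
by rewrite /gam /samp; ring.
Qed.

Lemma nF_add_kcomb F s b : in_fock F ->
  nF (fun z => F z + kcomb s b z) =
  nF F + 2 * complex.Re (\sum_(m <- s) (conjc (b m)) * samp F m) + gform s b.
Proof.
move=> fF; elim: s => [|m s IH].
  rewrite /gform !big_nil mulr0 !addr0; congr nF.
  by apply/funext => z; rewrite /kcomb big_nil addr0.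
have -> : (fun z => F z + kcomb (m :: s) b z) =
    (fun z => (F z + kcomb s b z) + b m * ker m z).
  by apply/funext => z; rewrite /kcomb big_cons; ring.
rewrite nF_add_ker; last by apply: in_fockD => //; exact: fock_kcomb.
rewrite IH sampD samp_kcomb /gform !big_cons gam_self.
have -> : \sum_(l <- s) (conjc (b l)) * \sum_(k <- m :: s) gam l k * b k =
    (b m * (conjc (\sum_(k <- s) gam m k * b k))) +
    \sum_(l <- s) (conjc (b l)) * \sum_(k <- s) gam l k * b k.
  rewrite rmorph_sum mulr_sumr -big_split /=; apply: eq_bigr => l _.
  by rewrite big_cons /= conjM [gam l m]gam_conj; ring.
set S1 := \sum_(k <- s) gam m k * b k.
set S2 := \sum_(l <- s) _ * \sum_(k <- s) _.
set S3 := \sum_(k <- s) _.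
rewrite mul1r !mulrDr !ReD.
have -> : complex.Re (b m * (conjc S1)) = complex.Re ((conjc (b m)) * S1).
  by case: (b m) S1 => [p q] [p' q'] /=; ring.
have -> : complex.Re ((conjc (b m)) * b m) = cabs2 (b m).
  by case: (b m) => [p q]; rewrite /cabs2 /=; ring.
ring.
Qed.

(* Nonnegativity of |F - t sum b_m k_m|^2 at t = 1/A. *)
Lemma gform_lower F s b (A : R) : in_fock F -> 0 < A ->
  (forall m, m \in s -> samp F m = b m) ->
  A * nF F <= \sum_(m <- s) cabs2 (b m) ->
  A * \sum_(m <- s) cabs2 (b m) <= gform s b.
Proof.
move=> fF A0 sF; set beta := \sum_(m <- s) _ => FA.
pose t := A^-1; have t0 : 0 < t by rewrite invr_gt0.
have := nF_ge0 (fun z => F z + kcomb s (fun m => (- t)%:C * b m) z).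
rewrite nF_add_kcomb//.
have -> : gform s (fun m => (- t)%:C * b m) = t ^+ 2 * gform s b.
  rewrite /gform; have -> : \sum_(l <- s) (conjc ((- t)%:C * b l)) *
      \sum_(m <- s) gam l m * ((- t)%:C * b m) =
      (t ^+ 2)%:C * \sum_(l <- s) (conjc (b l)) * \sum_(m <- s) gam l m * b m.
    rewrite mulr_sumr; apply: eq_bigr => l _.
    have -> : \sum_(m <- s) gam l m * ((- t)%:C * b m) =
      (- t)%:C * \sum_(m <- s) gam l m * b m.
      by rewrite mulr_sumr; apply: eq_bigr => m _; ring.
    by rewrite conjM_real rmorphXn rmorphN; ring.
  by rewrite ReM /= mul0r subr0.
have -> : complex.Re (\sum_(m <- s) (conjc ((- t)%:C * b m)) * samp F m) = - t * beta.
  rewrite Re_sum /beta mulr_sumr; apply: eq_big_seq => m ms; rewrite sF//; case: (b m) => p q.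
  by rewrite /cabs2 /=; ring.
move: (gform s b) => Q H.
have FA' : nF F <= t * beta by rewrite /t mulrC ler_pdivlMr// mulrC.
have : 0 <= t ^+ 2 * Q - t * beta by lra.
rewrite expr2 -mulrA -mulrBr pmulr_rge0// subr_ge0.
by rewrite /t mulrC ler_pdivlMr// mulrC.
Qed.

End Kernels.

(** * Off-diagonal decay of the Gram matrix *)

Section SchurBound.
Variables (R : realType) (d : nat).
Local Notation C := R[i].
Implicit Types (F G : 'rV[C]_d -> C) (z w l m : 'rV[C]_d) (s : seq 'rV[C]_d).

(** The values 1, -1, i, -i, indexed by two booleans so that choosing one per coordinate ranges over
    a finite type with 4^d elements. *)
Definition fourth_root (q : bool * bool) : C :=
  if q.1 then (if q.2 then 1 else -1) else (if q.2 then - 'i%C else 'i%C).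

Lemma Re_fourth_root_le q (x : C) :
  complex.Re (fourth_root q * (x * x)) <= cabs2 x.
Proof.
case: q x => [[] []] [a b]; rewrite /fourth_root /cabs2 ReM /=;
  have := sqr_ge0 (a - b); have := sqr_ge0 (a + b);
  have := sqr_ge0 a; have := sqr_ge0 b; nra.
Qed.

(* 7/10 is a rational lower bound for 1 / sqrt 2. *)
Lemma Re_fourth_root_ge (x : C) : exists q,
  7 / 10 * cabs2 x <= complex.Re (fourth_root q * (x * x)).
Proof.
case: x => a b; apply: contrapT => nq.
have H q : complex.Re (fourth_root q * ((a +i* b) * (a +i* b))) < 7 / 10 * cabs2 (a +i* b).
  by rewrite ltNge; apply/negP => hq; apply: nq; exists q.
have := H (true, true); have := H (true, false).
have := H (false, true); have := H (false, false).
rewrite /fourth_root /cabs2 !ReM /= => h1 h2 h3 h4.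
pose p := a ^+ 2 - b ^+ 2; pose r := 2 * (a * b); pose v := 7 / 10 * (a ^+ 2 + b ^+ 2).
have v0 : 0 <= v by rewrite mulr_ge0 ?addr_ge0 ?sqr_ge0// divr_ge0.
have p2 : p ^+ 2 <= v ^+ 2.
  rewrite -(@real_normK _ p) ?num_real// ler_pXn2r ?nnegrE ?normr_ge0//.
  by rewrite ler_norml; apply/andP; split; rewrite /p /v; lra.
have r2 : r ^+ 2 <= v ^+ 2.
  rewrite -(@real_normK _ r) ?num_real// ler_pXn2r ?nnegrE ?normr_ge0//.
  by rewrite ler_norml; apply/andP; split; rewrite /r /v; lra.
have E : p ^+ 2 + r ^+ 2 = (a ^+ 2 + b ^+ 2) ^+ 2 by rewrite /p /r; ring.
have : (a ^+ 2 + b ^+ 2) ^+ 2 <= 98 / 100 * (a ^+ 2 + b ^+ 2) ^+ 2.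
  by rewrite -E (le_trans (lerD p2 r2))// E /v le_eqVlt; apply/orP; left; apply/eqP; field.
move=> h5; have h6 : (a ^+ 2 + b ^+ 2) ^+ 2 <= 0.
  by move: ((a ^+ 2 + b ^+ 2) ^+ 2) h5 => u; lra.
have h7 : a ^+ 2 + b ^+ 2 = 0.
  by apply/eqP; rewrite -sqrf_eq0 eq_le h6 sqr_ge0.
have a0 : a = 0.
  apply/eqP; rewrite -sqrf_eq0 eq_le sqr_ge0 andbT -h7 lerDl; exact: sqr_ge0.
have b0 : b = 0.
  apply/eqP; rewrite -sqrf_eq0 eq_le sqr_ge0 andbT -h7 lerDr; exact: sqr_ge0.
by move: h1; rewrite a0 b0 !(mulr0,mul0r,addr0,subr0,expr0n) /= ltxx.
Qed.

(* Translates of the Gaussian only bound sums of exp(- pi |l - m|^2); these wider test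
   functions reach the exponent 11/25 pi < pi/2 that the Schur test needs. *)
Definition wide_test (om : {ffun 'I_d -> bool * bool}) m z : C :=
  cexp (\sum_j (2 / 5 * pi)%:C * (fourth_root (om j) * ((z - m) 0 j * (z - m) 0 j))) * ker m z.

Lemma entire_coordB m j : entire (fun z : 'rV[C]_d => (z - m) 0 j).
Proof.
have := entireD (entire_coord R j) (entire_cst d (- m 0 j)).
by rewrite (_ : (fun _ => _) = (fun z => (z - m) 0 j))//; apply/funext => z; rewrite !mxE.
Qed.

Lemma entire_wide_test om m : entire (wide_test om m).
Proof.
apply: entireM; last exact: entire_ker.
apply: (entire_comp (@cdiff_cexp R)); apply: entire_sum => j.
by do 2! apply: entireZ; apply: entireM; exact: entire_coordB.
Qed.

Lemma gweight_wide_test om m z : gweight (wide_test om m) z =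
  expR (4 / 5 * pi * (\sum_j complex.Re (fourth_root (om j) * ((z - m) 0 j * (z - m) 0 j))) -
        pi * vnorm2 (z - m)).
Proof.
rewrite /gweight /wide_test cabs2M -mulrA -/(gweight (ker m) z) gweight_ker.
rewrite cabs2_cexp -expRD; congr expR; rewrite mulNr; congr (_ - _).
rewrite Re_sum !mulr_sumr; apply: eq_bigr => j _.
by rewrite [complex.Re (_%:C * _)]ReM /= mul0r subr0; field.
Qed.

Lemma fock_wide_test om m : in_fock (wide_test om m) /\ nF (wide_test om m) <= 5 ^+ d.
Proof.
(* The quadratic factor contributes at most 4/5 pi |z - m|^2 to the exponent, leaving decay pi/5 and
   hence the norm bound (pi / (pi/5))^d = 5^d. *)
have H z : gweight (wide_test om m) z <= 1 * expR (- (pi / 5) * vnorm2 (z - m)).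
  rewrite gweight_wide_test mul1r ler_expR.
  have : \sum_j complex.Re (fourth_root (om j) * ((z - m) 0 j * (z - m) 0 j)) <= vnorm2 (z - m).
    by apply: ler_sum => j _; exact: Re_fourth_root_le.
  move: (\sum_j _) (vnorm2 _) => u v uv; rewrite -subr_ge0.
  have -> : - (pi / 5) * v - (4 / 5 * pi * u - pi * v) = 4 / 5 * pi * (v - u) by field.
  by rewrite mulr_ge0 ?subr_ge0// mulr_ge0 ?pi_ge0// divr_ge0.
have p5 : 0 < pi / 5 :> R by rewrite divr_gt0 ?pi_gt0.
have [f fle] := in_fock_gauss_bound (entire_wide_test om m) ler01 p5 H.
split=> //; rewrite -lee_fin -fock_norm2E// (le_trans fle)// lee_fin mul1r.
have -> // : pi / (pi / 5) = 5 :> R.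
by rewrite invf_div mulrCA mulfV ?mulr1// gt_eqF ?pi_gt0.
Qed.

Lemma sum_wide_test_ge m z : expR (- (11 / 25 * pi) * vnorm2 (z - m)) <=
  \sum_om gweight (wide_test om m) z.
Proof.
(* With the best root in each coordinate the exponent is at least (4/5 * 7/10 - 1) pi |z - m|^2 = -
   11/25 pi |z - m|^2. *)
have /choice[q Hq] : forall j : 'I_d, exists q,
    7 / 10 * cabs2 ((z - m) 0 j) <=
    complex.Re (fourth_root q * ((z - m) 0 j * (z - m) 0 j)).
  by move=> j; exact: Re_fourth_root_ge.
rewrite (bigD1 [ffun j => q j])//= (@le_trans _ _ (gweight (wide_test [ffun j => q j] m) z))//.
  rewrite gweight_wide_test ler_expR.
  have : 7 / 10 * vnorm2 (z - m) <= \sum_j complex.Re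
      (fourth_root ([ffun j => q j] j) * ((z - m) 0 j * (z - m) 0 j)).
    by rewrite /vnorm2 mulr_sumr; apply: ler_sum => j _; rewrite ffunE.
  move: (\sum_j _) (vnorm2 _) => u v uv; rewrite -subr_ge0.
  have -> : 4 / 5 * pi * u - pi * v - - (11 / 25 * pi) * v = 4 / 5 * pi * (u - 7 / 10 * v).
    by field.
  by rewrite mulr_ge0 ?subr_ge0// mulr_ge0 ?pi_ge0// divr_ge0.
by rewrite lerDl sumr_ge0// => om _; rewrite mulr_ge0 ?cabs2_ge0 ?expR_ge0.
Qed.

Definition finsub (L : set 'rV[C]_d) s := uniq s /\ (forall l, l \in s -> L l).

Definition bessel (L : set 'rV[C]_d) (B : R) :=
  forall F s, in_fock F -> finsub L s -> \sum_(l <- s) gweight F l <= B * nF F.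

(** The factor 20^d is the number 4^d of test functions times the norm bound 5^d. *)
Lemma bessel_gauss L B m s : 0 <= B -> bessel L B -> finsub L s ->
  \sum_(l <- s) expR (- (11 / 25 * pi) * vnorm2 (l - m)) <= 20 ^+ d * B.
Proof.
move=> B0 bL sL; apply: (@le_trans _ _ (\sum_(l <- s) \sum_om gweight (wide_test om m) l)).
  by apply: ler_sum => l _; exact: sum_wide_test_ge.
rewrite exchange_big /=.
apply: (@le_trans _ _ (\sum_(om : {ffun 'I_d -> bool * bool}) (5 ^+ d * B))).
  apply: ler_sum => om _; have [f fle] := fock_wide_test om m.
  by rewrite (le_trans (bL _ _ f sL))// mulrC ler_wpM2r.
rewrite sumr_const card_ffun card_ord card_prod card_bool.
rewrite le_eqVlt; apply/orP; left; apply/eqP.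
by rewrite -[LHS]mulr_natr natrX mulrAC -exprMn -natrM.
Qed.

Lemma vnorm2N z : vnorm2 (- z) = vnorm2 z.
Proof. by apply: eq_bigr => j _; rewrite mxE cabs2N. Qed.

Lemma vnorm2BC z w : vnorm2 (z - w) = vnorm2 (w - z).
Proof. by rewrite -vnorm2N opprB. Qed.

(** The factor 1 + |l - m| dominates both the ratio of weights at l and m and, up to eps, their
    difference. One row-sum bound thus serves boundedness and coercivity in the weighted norm. *)
Definition schur_ker l m : R :=
  (1 + vnorm (l - m)) * expR (- (pi / 2) * vnorm2 (l - m)).

Lemma schur_kerC l m : schur_ker l m = schur_ker m l.
Proof. by rewrite /schur_ker /vnorm (vnorm2BC l m). Qed.

Lemma schur_ker_ge0 l m : 0 <= schur_ker l m.
Proof. by rewrite mulr_ge0 ?expR_ge0// addr_ge0// sqrtr_ge0. Qed.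

Lemma schur_bound L B : 0 <= B -> bessel L B -> exists2 K : R, 0 < K &
  forall m s, finsub L s -> \sum_(l <- s) schur_ker l m <= K.
Proof.
(* The gap pi/2 - 11/25 pi between the two decay rates; it pays for the linear factor through 1 + r
   <= K0 (1 + e r^2) <= K0 exp(e r^2). *)
move=> B0 bL; pose e : R := 3 / 50 * pi.
have e0 : 0 < e by rewrite mulr_gt0 ?pi_gt0// divr_gt0.
pose K0 := 1 + e^-1; have K00 : 0 < K0 by rewrite addr_gt0 ?invr_gt0.
exists (K0 * (20 ^+ d * B) + 1).
  by rewrite ltr_wpDl// mulr_ge0 ?(ltW K00)// mulr_ge0// exprn_ge0.
move=> m s sL; apply: (@le_trans _ _ (K0 * (20 ^+ d * B))); last by rewrite lerDl.
have := bessel_gauss m B0 bL sL.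
rewrite -(ler_pM2l K00) mulr_sumr; apply: le_trans; apply: ler_sum => l _.
rewrite /schur_ker; have -> : vnorm2 (l - m) = vnorm (l - m) ^+ 2.
  by rewrite sqr_sqrtr ?vnorm2_ge0.
have : 0 <= vnorm (l - m) by exact: sqrtr_ge0.
move: (vnorm _) => r r0.
have -> : - (11 / 25 * pi) * r ^+ 2 = e * r ^+ 2 + - (pi / 2) * r ^+ 2 by rewrite /e; field.
rewrite expRD [leRHS]mulrA ler_pM2r ?expR_gt0//.
apply: (@le_trans _ _ (K0 * (1 + e * r ^+ 2))).
  have : 0 <= (e * r - 1) ^+ 2 * e^-1 by rewrite mulr_ge0 ?sqr_ge0// invr_ge0 ltW.
  have -> : (e * r - 1) ^+ 2 * e^-1 = e * r ^+ 2 - 2 * r + e^-1 by field; rewrite gt_eqF.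
  have -> : K0 * (1 + e * r ^+ 2) = 1 + e * r ^+ 2 + e^-1 + r ^+ 2.
    by rewrite /K0; field; rewrite gt_eqF.
  have := sqr_ge0 r; move: (e * r ^+ 2) (r ^+ 2) (e^-1) => x y v; lra.
by rewrite ler_pM2l// expR_ge1Dx.
Qed.

End SchurBound.

(** * Inverting the Gram matrix in a weighted norm *)

Section WeightedDescent.
Variables (R : realType) (d : nat).
Local Notation C := R[i].
Implicit Types (F G : 'rV[C]_d -> C) (z w l m : 'rV[C]_d) (s t S : seq 'rV[C]_d).

Lemma ler_sum_uniq (I : eqType) (s t : seq I) (f : I -> R) : uniq t -> {subset t <= s} ->
  uniq s -> (forall i, 0 <= f i) -> \sum_(i <- t) f i <= \sum_(i <- s) f i.
Proof.
move=> ut ts us f0.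
have p : perm_eq [seq i <- s | mem t i] t.
  apply: uniq_perm => //; first exact: filter_uniq.
  by move=> i; rewrite mem_filter /=; case: (boolP (i \in t)) => // /ts ->.
rewrite [leRHS](bigID (mem t)) /= -[X in X + _]big_filter (perm_big _ p).
by rewrite lerDl sumr_ge0.
Qed.

Lemma sum_cauchy (I : Type) (s : seq I) (k u : I -> R) (K : R) : 0 < K ->
  (forall i, 0 <= k i) -> \sum_(i <- s) k i <= K ->
  (\sum_(i <- s) k i * u i) ^+ 2 <= K * \sum_(i <- s) k i * u i ^+ 2.
Proof.
move=> K0 k0 kK; set Q := \sum_(i <- s) k i * u i.
(* Cauchy-Schwarz as nonnegativity of a weighted variance; Q / K is the mean when the total mass is
   exactly K. *)
have : 0 <= \sum_(i <- s) k i * (u i - Q / K) ^+ 2.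
  by apply: sumr_ge0 => i _; rewrite mulr_ge0 ?sqr_ge0.
have -> : \sum_(i <- s) k i * (u i - Q / K) ^+ 2 = \sum_(i <- s) k i * u i ^+ 2 -
    2 * (Q / K) * Q + (Q / K) ^+ 2 * \sum_(i <- s) k i.
  rewrite {3}/Q; move: (Q / K) => r.
  rewrite !mulr_sumr -sumrB -big_split /=; apply: eq_bigr => i _; ring.
set T := \sum_(i <- s) k i * u i ^+ 2 => H.
have : 0 <= T - 2 * (Q / K) * Q + (Q / K) ^+ 2 * K.
  by rewrite (le_trans H)// lerD2l ler_wpM2l ?sqr_ge0.
have -> : T - 2 * (Q / K) * Q + (Q / K) ^+ 2 * K = T - Q ^+ 2 / K.
  by field; rewrite gt_eqF.
by rewrite subr_ge0 ler_pdivrMr// mulrC.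
Qed.

Variables (L : set 'rV[C]_d) (K A : R) (eps : R) (wt : 'rV[C]_d -> R).
Hypothesis K0 : 0 < K.
Hypothesis A0 : 0 < A.
Hypothesis AK : A <= K.
Hypothesis schurK : forall m s, finsub L s -> \sum_(l <- s) schur_ker l m <= K.
Hypothesis gformA : forall s b, finsub L s ->
  A * \sum_(m <- s) cabs2 (b m) <= gform s b.
Hypothesis eps0 : 0 < eps.
Hypothesis eps1 : eps <= 1.
Hypothesis epsA : eps * K <= A / 2.
Hypothesis wt1 : forall l, 1 <= wt l.
Hypothesis wt_lip : forall l m, `|wt l - wt m| <= eps * vnorm (l - m).

Definition wnorm S (x : 'rV[C]_d -> C) := \sum_(l <- S) wt l ^+ 2 * cabs2 (x l).

Definition gam_op s (b : 'rV[C]_d -> C) l := \sum_(m <- s) gam l m * b m.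

Let wt0 l : 0 < wt l. Proof. exact: lt_le_trans (wt1 l). Qed.

Lemma wnorm_ge0 S x : 0 <= wnorm S x.
Proof. by apply: sumr_ge0 => l _; rewrite mulr_ge0 ?sqr_ge0 ?cabs2_ge0. Qed.

Lemma wt_cabs (l : 'rV[C]_d) (x : C) : wt l ^+ 2 * cabs2 x = (wt l * cabs x) ^+ 2.
Proof. by rewrite exprMn sqr_cabs. Qed.

Lemma cabs_gam_schur l m : vnorm (l - m) * cabs (gam l m) <= schur_ker l m.
Proof. by rewrite cabs_gam /schur_ker ler_wpM2r ?expR_ge0// lerDr. Qed.

(** Schur's test: wt l <= (1 + |l - m|) wt m moves the weight inside, and by symmetry [schur_ker]
    has rows and columns of sum at most K. *)
Lemma wnorm_gam_op S s b : finsub L S -> finsub L s ->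
  wnorm S (gam_op s b) <= K ^+ 2 * wnorm s b.
Proof.
move=> LS Ls; pose u m := wt m * cabs (b m).
have u0 m : 0 <= u m by rewrite mulr_ge0 ?cabs_ge0// ltW.
apply: (@le_trans _ _ (\sum_(l <- S) K * \sum_(m <- s) schur_ker l m * u m ^+ 2)).
  apply: ler_sum => l _; rewrite wt_cabs.
  apply: (@le_trans _ _ ((\sum_(m <- s) schur_ker l m * u m) ^+ 2)).
    rewrite ler_pXn2r ?nnegrE ?mulr_ge0 ?cabs_ge0 ?(ltW (wt0 l))//; last first.
      by apply: sumr_ge0 => m _; rewrite mulr_ge0 ?schur_ker_ge0.
    apply: (@le_trans _ _ (wt l * \sum_(m <- s) cabs (gam l m * b m))).
      rewrite ler_wpM2l ?(ltW (wt0 l))// /gam_op.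
      elim: (s) => [|m s' IH]; first by rewrite !big_nil cabs0.
      by rewrite !big_cons (le_trans (cabsD _ _))// lerD2l.
    rewrite mulr_sumr; apply: ler_sum => m _; rewrite cabsM cabs_gam /schur_ker /u.
    have wlm : wt l <= (1 + vnorm (l - m)) * wt m.
      have v0 : 0 <= vnorm (l - m) by exact: sqrtr_ge0.
      have := wt_lip l m; rewrite ler_norml => /andP[_ h1].
      have h2 : eps * vnorm (l - m) <= vnorm (l - m) * wt m.
        by rewrite mulrC ler_wpM2l// (le_trans eps1).
      by rewrite mulrDl mul1r -lerBlDl (le_trans h1).
    rewrite mulrCA [leRHS](_ : _ = expR (- (pi / 2) * vnorm2 (l - m)) *
      ((1 + vnorm (l - m)) * wt m * cabs (b m))); last by ring.
    by rewrite ler_wpM2l ?expR_ge0// ler_wpM2r ?cabs_ge0.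
  apply: sum_cauchy => // [m|]; first exact: schur_ker_ge0.
  by under eq_bigr do rewrite schur_kerC; exact: schurK.
rewrite -mulr_sumr exchange_big /= expr2 -mulrA ler_pM2l// /wnorm mulr_sumr.
apply: ler_sum => m _; rewrite -mulr_suml wt_cabs ler_wpM2r ?sqr_ge0//.
exact: schurK.
Qed.

(** Unweighted coercivity is applied to wt b. The resulting form differs from the weighted one by
    the commutator entries wt_l (wt_m - wt_l) Gam_lm, of size at most eps times [schur_ker] in the
    weighted variables. Schur's test bounds the difference by eps K <= A/2, half of the coercivity
    constant. *)
Lemma gam_op_coercive s b : finsub L s ->
  A / 2 * wnorm s b <=
  complex.Re (\sum_(l <- s) (wt l ^+ 2)%:C * (conjc (b l) * gam_op s b l)).
Proof.
move=> Ls; pose b' m := (wt m)%:C * b m; pose u m := wt m * cabs (b m).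
have u0 m : 0 <= u m by rewrite mulr_ge0 ?cabs_ge0// ltW.
have Eb : \sum_(m <- s) cabs2 (b' m) = wnorm s b.
  by apply: eq_bigr => m _; rewrite cabs2M cabs2_real.
have := gformA b' Ls; rewrite Eb /gform.
rewrite (_ : complex.Re (\sum_(l <- s) conjc (b' l) * _) =
    \sum_(l <- s) \sum_(m <- s) complex.Re (conjc (b' l) * (gam l m * b' m))); last first.
  by rewrite Re_sum; apply: eq_bigr => l _; rewrite mulr_sumr Re_sum.
rewrite (_ : complex.Re (\sum_(l <- s) (wt l ^+ 2)%:C * _) =
    \sum_(l <- s) \sum_(m <- s)
      complex.Re ((wt l ^+ 2)%:C * (conjc (b l) * (gam l m * b m)))); last first.
  by rewrite Re_sum; apply: eq_bigr => l _; rewrite /gam_op !mulr_sumr Re_sum.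
set X := \sum_(l <- s) _; set Y := \sum_(l <- s) _ => AX.
suff XY : X - Y <= A / 2 * wnorm s b.
  have E : A * wnorm s b = A / 2 * wnorm s b + A / 2 * wnorm s b by field.
  move: XY AX; rewrite E; move: (A / 2 * wnorm s b) => q; lra.
have half : \sum_(l <- s) \sum_(m <- s) schur_ker l m * u l ^+ 2 <= K * wnorm s b.
  rewrite /wnorm mulr_sumr; apply: ler_sum => l _.
  rewrite -mulr_suml wt_cabs ler_wpM2r ?sqr_ge0//.
  by under eq_bigr do rewrite schur_kerC; exact: schurK.
have half' : \sum_(l <- s) \sum_(m <- s) schur_ker l m * u m ^+ 2 <= K * wnorm s b.
  rewrite exchange_big /= (le_trans _ half)// le_eqVlt; apply/orP; left; apply/eqP.
  by apply: eq_bigr => l _; apply: eq_bigr => m _; rewrite schur_kerC.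
apply: (@le_trans _ _ (eps * (K * wnorm s b))); last first.
  by rewrite mulrA ler_wpM2r ?wnorm_ge0.
apply: (@le_trans _ _ (eps * (2^-1 * (\sum_(l <- s) \sum_(m <- s) schur_ker l m * u l ^+ 2 +
    \sum_(l <- s) \sum_(m <- s) schur_ker l m * u m ^+ 2)))); last first.
  rewrite ler_wpM2l ?(ltW eps0)//; move: half half'.
  move: (\sum_(l <- s) _) (\sum_(l <- s) _) => p q.
  by move: (K * _) => r; lra.
rewrite -big_split /= /X /Y -sumrB !mulr_sumr; apply: ler_sum => l _.
rewrite -big_split /= -sumrB !mulr_sumr; apply: ler_sum => m _.
have hg := cabs_gam_schur l m; move: hg; move: (gam l m) => g hg.
have -> : complex.Re (conjc (b' l) * (g * b' m)) -
    complex.Re ((wt l ^+ 2)%:C * (conjc (b l) * (g * b m))) =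
    complex.Re ((wt l * (wt m - wt l))%:C * (conjc (b l) * (g * b m))).
  rewrite -ReN -ReD; congr complex.Re; rewrite /b' conjM_real.
  by rewrite !(rmorphM, rmorphB, rmorphXn) /=; ring.
apply: (le_trans (ler_norm _)); apply: (le_trans (normRe_cabs _)).
rewrite !cabsM cabs_real cabs_conj normrM (gtr0_norm (wt0 l)) distrC.
have ug : eps * (schur_ker l m * (u l * u m)) <=
    eps * (2^-1 * (schur_ker l m * u l ^+ 2 + schur_ker l m * u m ^+ 2)).
  rewrite ler_wpM2l ?(ltW eps0)// -mulrDr [leRHS]mulrCA ler_wpM2l ?schur_ker_ge0//.
  have := sqr_ge0 (u l - u m); have -> : (u l - u m) ^+ 2 =
    2 * (2^-1 * (u l ^+ 2 + u m ^+ 2) - u l * u m) by field.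
  by rewrite pmulr_rge0// subr_ge0.
apply: le_trans ug.
have h1 : `|wt l - wt m| * cabs g <= eps * schur_ker l m.
  apply: (@le_trans _ _ (eps * (vnorm (l - m) * cabs g))).
    by rewrite mulrA ler_wpM2r ?cabs_ge0.
  by rewrite ler_wpM2l ?(ltW eps0).
have h2 : cabs (b m) <= u m by rewrite ler_peMl ?cabs_ge0.
rewrite [leLHS](_ : _ = (`|wt l - wt m| * cabs g) * (u l * cabs (b m))); last by rewrite /u; ring.
rewrite [leRHS](_ : _ = (eps * schur_ker l m) * (u l * u m)); last by ring.
have h3 : u l * cabs (b m) <= u l * u m by rewrite ler_wpM2l.
by apply: (ler_pM _ _ h1 h3); rewrite mulr_ge0 ?cabs_ge0.
Qed.

(** A bound on the squared weighted l^2 norm over all of L, expressed through finite subsets. *)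
Definition wbound (x : 'rV[C]_d -> C) (M : R) := forall S, finsub L S -> wnorm S x <= M.

(** [tau] minimizes - tau A + 2 tau^2 K^2, and the minimum is - [kap]: the relative decrease in one
    step, with a factor 2 to spare for the crude bound off the chosen finite set. *)
Let kap := A ^+ 2 / (8 * K ^+ 2).
Let tau := A / (4 * K ^+ 2).

Let kap_gt0 : 0 < kap.
Proof. by rewrite divr_gt0 ?mulr_gt0 ?exprn_gt0. Qed.

Let kap_le1 : kap <= 1.
Proof.
rewrite ler_pdivrMr ?mulr_gt0 ?exprn_gt0// mul1r.
apply: (@le_trans _ _ (K ^+ 2)); first by rewrite ler_pXn2r ?nnegrE ?(ltW A0) ?(ltW K0).
by rewrite ler_peMl ?sqr_ge0// ler1n.
Qed.

Lemma wnorm_cat S S' x : wnorm (S ++ S') x = wnorm S x + wnorm S' x.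
Proof. by rewrite /wnorm big_cat. Qed.

(* One step of Richardson iteration on a finite set carrying nearly all of the
   residual x; what lies outside that set costs at most twice its own norm. *)
Lemma descent_step x M : wbound x M -> exists s b, finsub L s /\
  wbound (fun l => x l - gam_op s b l) ((1 - kap / 4) * M).
Proof.
move=> xM.
(* Either x already satisfies the smaller bound, and the empty combination works, or some finite s
   carries more than the fraction 1 - kap/4 of M. *)
have [small|big] := pselect (wbound x ((1 - kap / 4) * M)).
  exists [::], (fun=> 0); split; first by split.
  move=> S LS; rewrite (le_trans _ (small S LS))// le_eqVlt; apply/orP; left.
  by apply/eqP; apply: eq_bigr => l _; rewrite /gam_op big_nil subr0.
have [s [Ls Ns]] : exists s, finsub L s /\ (1 - kap / 4) * M < wnorm s x.
  apply: contrapT => ns; apply: big => S LS; rewrite leNgt; apply/negP => h.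
  by apply: ns; exists S.
exists s, (fun m => tau%:C * x m); split=> // S LS.
set y := gam_op s x.
have -> : wnorm S (fun l => x l - gam_op s (fun m => tau%:C * x m) l) =
    wnorm S (fun l => x l - tau%:C * y l).
  apply: eq_bigr => l _; congr (_ * cabs2 (_ - _)).
  by rewrite /y /gam_op mulr_sumr; apply: eq_bigr => m _; ring.
(* On s coercivity gives a decrease; on t only |a - b|^2 <= 2 |a|^2 + 2 |b|^2 is available, but
   there x has mass at most M - N because s ++ t is again a finite subset. *)
pose t := [seq l <- S | l \notin s].
have Lt : finsub L t.
  split; first by rewrite filter_uniq; case: LS.
  by move=> l; rewrite mem_filter => /andP[_]; case: LS => _; apply.
have Lst : finsub L (s ++ t).
  split; last by move=> l; rewrite mem_cat => /orP[]; [case: Ls => _; apply|case: Lt => _; apply].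
  rewrite cat_uniq (proj1 Ls) (proj1 Lt) /= andbT; apply/hasPn => l.
  by rewrite mem_filter => /andP[].
apply: (@le_trans _ _ (wnorm (s ++ t) (fun l => x l - tau%:C * y l))).
  apply: ler_sum_uniq; [by case: LS| |by case: Lst|].
    by move=> l lS; rewrite mem_cat mem_filter lS andbT orbN.
  by move=> l; rewrite mulr_ge0 ?sqr_ge0 ?cabs2_ge0.
have xst := xM _ Lst; have yst := wnorm_gam_op x Lst Ls.
have co := gam_op_coercive x Ls; rewrite -/y in yst co.
rewrite !wnorm_cat in xst yst *; set N := wnorm s x in Ns xst yst co *.
have inner : wnorm s (fun l => x l - tau%:C * y l) =
    N - 2 * tau * complex.Re (\sum_(l <- s) (wt l ^+ 2)%:C * (conjc (x l) * y l)) +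
    tau ^+ 2 * wnorm s y.
  rewrite /N /wnorm Re_sum !mulr_sumr -sumrB -big_split /=; apply: eq_bigr => l _.
  rewrite [complex.Re (_%:C * _)]ReM /= mul0r subr0.
  by case: (x l) (y l) => [a b] [a' b']; rewrite /cabs2 /=; ring.
have outer : wnorm t (fun l => x l - tau%:C * y l) <=
    2 * wnorm t x + 2 * tau ^+ 2 * wnorm t y.
  rewrite /wnorm !mulr_sumr -big_split /=; apply: ler_sum => l _.
  rewrite (_ : 2 * _ + _ = wt l ^+ 2 * (2 * cabs2 (x l) + 2 * cabs2 (- (tau%:C * y l)))).
    by rewrite ler_wpM2l ?sqr_ge0// cabs2D_le.
  by rewrite cabs2N cabs2M cabs2_real; ring.
have tau0 : 0 < tau by rewrite divr_gt0 ?mulr_gt0 ?exprn_gt0.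
have t2 : 0 <= tau ^+ 2 by exact: sqr_ge0.
rewrite inner; apply: (le_trans (lerD (lexx _) outer)).
have c1 : tau * A * N <=
    2 * tau * complex.Re (\sum_(l <- s) (wt l ^+ 2)%:C * (conjc (x l) * y l)).
  have -> : tau * A * N = 2 * tau * (A / 2 * N) by field.
  by rewrite ler_wpM2l// mulr_ge0// ltW.
have c2 : tau ^+ 2 * wnorm s y + 2 * tau ^+ 2 * wnorm t y <= 2 * tau ^+ 2 * (K ^+ 2 * N).
  apply: (@le_trans _ _ (2 * tau ^+ 2 * (wnorm s y + wnorm t y))).
    by rewrite mulrDr lerD2r -mulrA ler_peMl ?ler1n// mulr_ge0// wnorm_ge0.
  by rewrite ler_wpM2l// mulr_ge0.
have E : - (tau * A * N) + 2 * tau ^+ 2 * (K ^+ 2 * N) = - (kap * N).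
  by rewrite /tau /kap; field; rewrite gt_eqF.
have M0 : 0 <= M by have := xM [::] (conj isT (fun l (h : l \in [::]) => False_ind _ (notF h)));
  rewrite /wnorm big_nil.
(* The two pieces total at most (1 - kap) N + 2 (M - N). Inserting N > (1 - kap/4) M leaves a margin
   of kap (2 - kap) / 4 times M. *)
have final : 2 * M - (1 + kap) * N <= (1 - kap / 4) * M.
  apply: (@le_trans _ _ (2 * M - (1 + kap) * ((1 - kap / 4) * M))).
    by rewrite lerD2l lerN2 ler_pM2l ?ltW// addr_gt0.
  have : 0 <= kap * (2 - kap) / 4 * M.
    rewrite mulr_ge0// divr_ge0// mulr_ge0 ?(ltW kap_gt0)// subr_ge0.
    by rewrite (le_trans kap_le1)// ler1n.
  move=> h; rewrite -subr_ge0; move: h; move: kap => k.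
  have -> : (1 - k / 4) * M - (2 * M - (1 + k) * ((1 - k / 4) * M)) =
    k * (2 - k) / 4 * M by field.
  by [].
apply: le_trans final.
have -> : (1 + kap) * N = N + kap * N by ring.
move: c1 c2 E xst.
move: (2 * tau * complex.Re _) (tau * A * N) (tau ^+ 2 * wnorm s y)
  (2 * tau ^+ 2 * wnorm t y) (2 * tau ^+ 2 * (K ^+ 2 * N)) (kap * N) (wnorm t x).
move=> p1 p2 p3 p4 p5 p6 p7; lra.
Qed.

End WeightedDescent.

(** * Sampling against interpolation *)

Section SamplingInterpolation.
Variables (R : realType) (d : nat).
Local Notation C := R[i].
Implicit Types (F G : 'rV[C]_d -> C) (z w l m : 'rV[C]_d) (s t S : seq 'rV[C]_d).
Implicit Types (L : set 'rV[C]_d).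

Lemma sum_le_esum L S (f : 'rV[C]_d -> R) : finsub L S ->
  ((\sum_(l <- S) f l)%:E <= \esum_(l in L) (f l)%:E)%E.
Proof.
move=> [uS SL]; apply: esum_ge; exists [set` S].
  by split; [exact: finite_seq|exact: SL].
by rewrite -fsbig_seq// sumEFin.
Qed.

Lemma esum_le_bound L (f : 'rV[C]_d -> R) (M : R) :
  (forall S, finsub L S -> \sum_(l <- S) f l <= M) ->
  (\esum_(l in L) (f l)%:E <= M%:E)%E.
Proof.
move=> H; apply: ge_ereal_sup => _ [X [fX XL] <-].
rewrite fsbig_finite//= sumEFin lee_fin; apply: H; split; first exact: fset_uniq.
by move=> l; rewrite in_fset_set// => /set_mem /XL.
Qed.

Lemma sum_restrict_le s S (b : 'rV[C]_d -> C) : uniq s -> uniq S ->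
  \sum_(l <- S) cabs2 (if l \in s then b l else 0) <= \sum_(l <- s) cabs2 (b l).
Proof.
move=> us uS; apply: (@le_trans _ _ (\sum_(l <- [seq l <- S | l \in s]) cabs2 (b l))).
  rewrite big_filter [leRHS]big_mkcond /= le_eqVlt; apply/orP; left; apply/eqP.
  by apply: eq_bigr => l _; case: ifP => // _; rewrite cabs2_0.
apply: ler_sum_uniq => //; first exact: filter_uniq.
  by move=> l; rewrite mem_filter => /andP[].
by move=> l; exact: cabs2_ge0.
Qed.

(** Half of the Gaussian decay of the kernel is spent on the quadratic growth of |z_j - a|^2,
    through v <= (pi/2)^-1 exp(pi v / 2). *)
Lemma in_fock_coordM_ker (a : C) m j : in_fock (fun z => (z 0 j - a) * ker m z).
Proof.
pose c := 2 * cabs2 (m 0 j - a); have c0 : 0 <= c by rewrite mulr_ge0 ?cabs2_ge0.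
have eF : entire (fun z : 'rV[C]_d => (z 0 j - a) * ker m z).
  by apply: entireM; [apply: entireD; [exact: entire_coord|exact: entire_cst]|exact: entire_ker].
have p2 : 0 < pi / 2 :> R by rewrite divr_gt0 ?pi_gt0.
have q0 : 0 <= 2 * (pi / 2)^-1 :> R by rewrite mulr_ge0// invr_ge0 ltW.
apply: (@in_fock_gauss_bound R d _ (2 * (pi / 2)^-1 + c) (pi / 2) m eF _ p2 _).1.
  exact: addr_ge0.
move=> z; rewrite /gweight cabs2M -mulrA -/(gweight (ker m) z) gweight_ker.
have -> : - pi * vnorm2 (z - m) = pi / 2 * - vnorm2 (z - m) + - (pi / 2) * vnorm2 (z - m).
  by field.
rewrite expRD mulrA ler_pM2r ?expR_gt0//.
have zj : cabs2 (z 0 j - a) <= 2 * vnorm2 (z - m) + c.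
  have -> : z 0 j - a = (z - m) 0 j + (m 0 j - a) by rewrite !mxE; ring.
  by rewrite (le_trans (cabs2D_le _ _))// lerD2r ler_pM2l// cabs2_le_vnorm2.
have v0 := vnorm2_ge0 (z - m); move: v0 zj; move: (vnorm2 _) => v v0 zj.
rewrite mulrN expRN ler_pdivrMr ?expR_gt0// (le_trans zj)//.
rewrite [leRHS]mulrDl; apply: lerD.
  rewrite -mulrA ler_pM2l// mulrC ler_pdivlMr// mulrC.
  by rewrite (le_trans _ (expR_ge1Dx _))// lerDr.
by rewrite ler_peMr// (le_trans _ (expR_ge1Dx _))// lerDl mulr_ge0// ltW.
Qed.

Lemma in_fock_coordM_kcomb (a : C) s b j : in_fock (fun z => (z 0 j - a) * kcomb s b z).
Proof.
elim: s => [|m s IH].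
  rewrite (_ : (fun _ => _) = fun=> 0); first exact: in_fock0.
  by apply/funext => z; rewrite /kcomb big_nil mulr0.
rewrite (_ : (fun _ => _) =
    fun z => b m * ((z 0 j - a) * ker m z) + (z 0 j - a) * kcomb s b z).
  by apply: in_fockD => //; apply: in_fockZ; exact: in_fock_coordM_ker.
by apply/funext => z; rewrite /kcomb big_cons; ring.
Qed.

Lemma samp_eq0 F w : samp F w = 0 -> F w = 0.
Proof.
move/eqP; rewrite /samp mulf_eq0 => /orP[/eqP//|].
by rewrite -cabs_eq0 cabs_real normr_eq0 gt_eqF ?expR_gt0.
Qed.

(** * The contradiction, from bounds over finite subsets of L *)

Section Contradiction.
Variables (L : set 'rV[C]_d) (A B : R).
Hypothesis A0 : 0 < A.
Hypothesis B0 : 0 <= B.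
Hypothesis Bessel : bessel L B.
Hypothesis Lower : forall F (M : R), in_fock F ->
  (forall S, finsub L S -> \sum_(l <- S) gweight F l <= M) -> A * nF F <= M.
Hypothesis Interp : forall s (b : 'rV[C]_d -> C), finsub L s ->
  exists F, in_fock F /\ forall l, L l -> samp F l = if l \in s then b l else 0.

(** Here the two properties meet. The interpolant of b, zero on the rest of L, has norm controlled
    by the lower sampling inequality, with the same A for every s; this is the uniformity that the
    open mapping theorem usually provides. *)
Lemma gform_lower_sampling s b : finsub L s -> A * \sum_(m <- s) cabs2 (b m) <= gform s b.
Proof.
move=> Ls; have [F [fF sF]] := Interp b Ls.
apply: (gform_lower fF A0).
  by move=> m ms; rewrite sF ?ms//; case: Ls => _; apply.
apply: Lower fF _ => S [uS SL]; apply: le_trans (sum_restrict_le b Ls.1 uS).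
rewrite le_eqVlt; apply/orP; left; apply/eqP.
by apply: eq_big_seq => l lS; rewrite -cabs2_samp sF//; exact: SL.
Qed.

Variables (l0 : 'rV[C]_d) (j : 'I_d).
Hypothesis Ll0 : L l0.

Let e l : C := if l == l0 then 1 else 0.

(** Iterated [descent_step] shrinks the weighted residual geometrically. Each step adds a finite
    kernel combination, so the product with z_j - l0_j stays in the Fock space at every stage. *)
Lemma weighted_approx : exists2 eps : R, 0 < eps & forall delta : R, 0 < delta ->
  exists G, [/\ in_fock G, in_fock (fun z => (z 0 j - l0 0 j) * G z) &
    forall S, finsub L S ->
      \sum_(l <- S) (1 + eps * cabs (l 0 j - l0 0 j)) ^+ 2 * cabs2 (e l - samp G l) <= delta].
Proof.
have [K' K'0 schurK'] := schur_bound B0 Bessel.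
(* Enlarging the Schur constant by A secures A <= K, hence kap <= 1. *)
pose K := K' + A.
have K0 : 0 < K by rewrite addr_gt0.
have AK : A <= K by rewrite lerDr ltW.
have schurK m s : finsub L s -> \sum_(l <- s) schur_ker l m <= K.
  by move=> Ls; rewrite (le_trans (schurK' m s Ls))// lerDl ltW.
pose eps := Num.min 1 (A / 2 / K).
have eps0 : 0 < eps by rewrite lt_min ltr01 !divr_gt0.
have eps1 : eps <= 1 by rewrite ge_min lexx.
have epsA : eps * K <= A / 2 by rewrite -ler_pdivlMr// ge_min lexx orbT.
clearbody eps K; exists eps => // delta delta0.
pose wt l := 1 + eps * cabs (l 0 j - l0 0 j).
have wt1 l : 1 <= wt l by rewrite lerDl mulr_ge0 ?cabs_ge0// ltW.
have wt_lip l m : `|wt l - wt m| <= eps * vnorm (l - m).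
  have -> : wt l - wt m = eps * (cabs (l 0 j - l0 0 j) - cabs (m 0 j - l0 0 j)).
    by rewrite /wt; ring.
  rewrite normrM (gtr0_norm eps0) ler_pM2l//.
  apply: le_trans (cabs_le_vnorm (l - m) j); rewrite !mxE.
  have h (x y v : C) : cabs (x - v) - cabs (y - v) <= cabs (x - y).
    rewrite lerBlDr; have -> : x - v = (x - y) + (y - v) by ring.
    exact: cabsD.
  by rewrite ler_norml h andbT lerNl opprB [leRHS]cabsBC h.
have step := descent_step K0 A0 AK schurK gform_lower_sampling eps0 eps1 epsA wt1 wt_lip.
pose kap := A ^+ 2 / (8 * K ^+ 2).
pose q := 1 - kap / 4.
have k0 : 0 < kap by rewrite divr_gt0 ?mulr_gt0 ?exprn_gt0.
have k1 : kap <= 1.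
  rewrite ler_pdivrMr ?mulr_gt0 ?exprn_gt0// mul1r.
  apply: (@le_trans _ _ (K ^+ 2)); first by rewrite ler_pXn2r ?nnegrE ?(ltW A0) ?(ltW K0).
  by rewrite ler_peMl ?sqr_ge0// ler1n.
have q0 : 0 <= q.
  by rewrite subr_ge0 ler_pdivrMr// mul1r (le_trans k1)// ler1n.
have q1 : q < 1 by rewrite /q ltrBlDr ltrDl divr_gt0.
(* The start G = 0 has residual e, of weighted norm at most 1 because the weight at [l0] is 1. *)
have iter n : exists G, [/\ in_fock G, in_fock (fun z => (z 0 j - l0 0 j) * G z) &
    wbound L wt (fun l => e l - samp G l) (q ^+ n)].
  elim: n => [|n [G [fG fzG Gb]]].
    exists (fun=> 0); split; first exact: in_fock0.
      by under eq_fun do rewrite mulr0; exact: in_fock0.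
    move=> S LS; rewrite expr0 /wnorm.
    have := @sum_restrict_le [:: l0] S (fun=> 1) isT LS.1.
    rewrite big_seq1 -[cabs2 1]sqr_cabs cabs1 expr1n; apply: le_trans.
    apply: ler_sum => l _; rewrite /samp mul0r subr0 /e inE.
    case: eqP => [->|_]; last by rewrite cabs2_0 mulr0.
    by rewrite /wt subrr cabs0 mulr0 addr0 expr1n mul1r.
  have [s [b [Ls Hb]]] := step _ _ Gb.
  exists (fun z => G z + kcomb s b z); split.
  - by apply: in_fockD => //; exact: fock_kcomb.
  - rewrite (_ : (fun _ => _) =
      fun z => (z 0 j - l0 0 j) * G z + (z 0 j - l0 0 j) * kcomb s b z).
      by apply: in_fockD => //; exact: in_fock_coordM_kcomb.
    by apply/funext => z; rewrite mulrDr.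
  - move=> S LS; rewrite exprS; apply: le_trans (Hb S LS).
    rewrite le_eqVlt; apply/orP; left; apply/eqP; apply: eq_bigr => l _.
    by rewrite sampD samp_kcomb opprD addrA.
have [n qn] : exists n, q ^+ n < delta.
  have : (q ^+ n) @[n --> \oo] --> (0 : R) by apply: cvg_expr; rewrite ger0_norm.
  move=> /cvgrPdist_lt/(_ _ delta0)[N _ HN]; exists N; have := HN N (leqnn _).
  by rewrite /= sub0r normrN ger0_norm ?exprn_ge0.
have [G [fG fzG Gb]] := iter n; exists G; split=> // S LS.
by apply: ltW; apply: le_lt_trans qn; exact: Gb.
Qed.

Lemma sampling_interpolation_false : False.
Proof.
have [eps eps0 approx] := weighted_approx.
have Ls1 : finsub L [:: l0] by split=> // l; rewrite inE => /eqP ->.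
have [F [fF sF]] := Interp (fun=> 1) Ls1.
have sFe l : L l -> samp F l = e l by move=> Ll; rewrite sF// inE.
(* For fixed u the factor of delta is a constant, so letting delta tend to 0 forces F(u) = 0
   whenever u_j differs from l0_j. *)
have bound (u : 'rV[C]_d) (delta : R) : 0 < delta -> cabs2 (u 0 j - l0 0 j) * cabs2 (samp F u) <=
    delta * (2 * cabs2 (u 0 j - l0 0 j) / A + 2 / (A * eps ^+ 2)).
  move=> delta0; have [G [fG fzG Gb]] := approx _ delta0.
  have fFG := in_fockD fF (in_fockZ (-1) fG).
  have nFG : A * nF (fun z => F z + (-1) * G z) <= delta.
    apply: Lower fFG _ => S LS; apply: le_trans (Gb S LS).
    rewrite big_seq [leRHS]big_seq; apply: ler_sum => l lS.
    rewrite -cabs2_samp sampD sampZ mulN1r sFe; last exact: LS.2.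
    by rewrite ler_peMl ?cabs2_ge0// exprn_ege1// lerDl mulr_ge0 ?cabs_ge0// ltW.
  have nzG : A * nF (fun z => (z 0 j - l0 0 j) * G z) <= delta / eps ^+ 2.
    apply: Lower fzG _ => S LS; rewrite ler_pdivlMr ?exprn_gt0//.
    apply: le_trans (Gb S LS); rewrite mulr_suml; apply: ler_sum => l _.
    rewrite -cabs2_samp; have -> : samp (fun z => (z 0 j - l0 0 j) * G z) l =
      (l 0 j - l0 0 j) * samp G l by rewrite /samp mulrA.
    (* At [l0] the factor z_j - l0_j kills the sample. Elsewhere e vanishes, so the residual is the
       sample of G up to sign, and the weight dominates eps |l_j - l0_j|. *)
    have [->|ll0] := eqVneq l l0.
      by rewrite subrr mul0r cabs2_0 mul0r mulr_ge0 ?sqr_ge0 ?cabs2_ge0.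
    rewrite /e (negPf ll0) sub0r cabs2N cabs2M mulrAC ler_wpM2r ?cabs2_ge0//.
    rewrite -sqr_cabs -exprMn ler_pXn2r ?nnegrE ?mulr_ge0 ?addr_ge0 ?cabs_ge0 ?(ltW eps0)//.
      by rewrite mulrC lerDr.
    by rewrite mulr_ge0 ?cabs_ge0// ltW.
  have h1 : cabs2 (samp F u - samp G u) <= delta / A.
    rewrite ler_pdivlMr// mulrC; apply: le_trans nFG; rewrite ler_pM2l//.
    by have := cabs2_samp_le u fFG; rewrite sampD sampZ mulN1r.
  have h2 : cabs2 (u 0 j - l0 0 j) * cabs2 (samp G u) <= delta / eps ^+ 2 / A.
    rewrite ler_pdivlMr// mulrC; apply: le_trans nzG; rewrite ler_pM2l// -cabs2M.
    by have := cabs2_samp_le u fzG; rewrite /samp mulrA.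
  have h3 : cabs2 (samp F u) <= 2 * cabs2 (samp F u - samp G u) + 2 * cabs2 (samp G u).
    by rewrite (le_trans _ (cabs2D_le _ _))// subrK.
  move: h2 h3; have := cabs2_ge0 (u 0 j - l0 0 j).
  move: (cabs2 (u 0 j - l0 0 j)) => p p0 h2 h3.
  apply: (@le_trans _ _ (2 * p * (delta / A) + 2 * (delta / eps ^+ 2 / A))).
    apply: (@le_trans _ _ (p * (2 * cabs2 (samp F u - samp G u) + 2 * cabs2 (samp G u)))).
      by rewrite ler_wpM2l.
    rewrite mulrDr; apply: lerD; last by rewrite mulrCA ler_pM2l.
    by rewrite mulrCA mulrA ler_wpM2l// mulr_ge0.
  rewrite le_eqVlt; apply/orP; left; apply/eqP; field.
  by rewrite !gt_eqF.
have F0 (u : 'rV[C]_d) : u 0 j != l0 0 j -> F u = 0.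
  move=> uj; apply: samp_eq0; apply/eqP; rewrite -cabs_eq0 -sqrf_eq0 sqr_cabs eq_le cabs2_ge0 andbT.
  have p0 : 0 < cabs2 (u 0 j - l0 0 j) by rewrite -sqr_cabs exprn_gt0// cabs_gt0 subr_eq0.
  rewrite -(ler_pM2l p0) mulr0; apply/ler_addgt0Pr => r r0; rewrite add0r.
  set c := 2 * cabs2 (u 0 j - l0 0 j) / A + 2 / (A * eps ^+ 2).
  have c0 : 0 < c.
    by rewrite addr_gt0// divr_gt0 ?mulr_gt0 ?exprn_gt0.
  have := bound u (r / c) (divr_gt0 r0 c0); rewrite -/c mulfVK// gt_eqF//.
(* Moving from [l0] by dl/2 in direction j leaves the hyperplane, where F is already 0; continuity
   then gives the value at [l0]. *)
have Fl0 : F l0 = 0.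
  apply/eqP; rewrite -cabs_eq0 eq_le cabs_ge0 andbT; apply/ler_addgt0Pr => r r0.
  rewrite add0r; have [dl dl0 Hd] := fF.1.1 l0 r r0.
  have := Hd (l0 + coord_vec j (dl / 2)%:C); rewrite addrC addKr => H.
  have dl20 : 0 < dl / 2 by rewrite divr_gt0.
  have : vnorm (coord_vec j (dl / 2)%:C : 'rV[C]_d) < dl.
    rewrite vnorm_lt//; have := @vnorm2_coordD R d 0 j (dl / 2)%:C; rewrite !add0r mxE => -> //.
    rewrite (_ : vnorm2 0 = 0) ?add0r; last first.
      by rewrite /vnorm2 big1// => k _; rewrite mxE cabs2_0.
    rewrite cabs2_real ltr_pXn2r ?nnegrE ?ltW//.
    by rewrite ltr_pdivrMr// ltr_pMr// ltr1n.
  move=> /H; rewrite F0; first by rewrite sub0r cabsN => /ltW.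
  rewrite !mxE eqxx -subr_eq0 addrAC subrr add0r.
  by rewrite -cabs_eq0 cabs_real normr_eq0 gt_eqF.
have := sFe l0 Ll0; rewrite /samp Fl0 mul0r /e eqxx => /esym/eqP.
by rewrite oner_eq0.
Qed.

End Contradiction.
End SamplingInterpolation.

Theorem mainTheorem9 (R : realType) (d : nat) : (1 <= d)%N ->
  ~ exists L : set 'rV[R[i]]_d, sampling_set L /\ interpolation_set L.
Proof.
move=> d1 [L [[A [B [A0 AB samplingL]]] interpL]].
have B0 : 0 <= B by rewrite (le_trans (ltW A0)).
have lower F M : in_fock F ->
    (forall S, finsub L S -> \sum_(l <- S) gweight F l <= M) -> A * nF F <= M.
  move=> fF H; have [h _] := samplingL F fF.
  rewrite -lee_fin EFinM -fock_norm2E//; apply: le_trans h _.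
  exact: esum_le_bound.
have bessel_L : bessel L B.
  move=> F s fF Ls; have [_ h] := samplingL F fF.
  rewrite -lee_fin EFinM -fock_norm2E//; apply: le_trans h.
  exact: sum_le_esum.
have interp s (b : 'rV[R[i]]_d -> R[i]) : finsub L s ->
    exists F, in_fock F /\ forall l, L l -> samp F l = if l \in s then b l else 0.
  (* Data supported on a finite subset are square summable, so interpolation applies to their
     extension by zero. *)
  move=> Ls; have [|F [fF HF]] := interpL (fun l => if l \in s then b l else 0).
    apply: (@le_lt_trans _ _ (\sum_(l <- s) cabs2 (b l))%:E); last exact: ltry.
    apply: esum_le_bound => S LS; exact: (sum_restrict_le b Ls.1 LS.1).
  by exists F; split.
(* If L were empty, the lower sampling bound would give the kernel at 0 norm zero, although its
   sample at 0 is 1. *)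
have [l0 Ll0] : exists l0, L l0.
  apply: contrapT => nL; have [fk _] := fock_ker (0 : 'rV[R[i]]_d).
  have : A * nF (ker (0 : 'rV[R[i]]_d)) <= 0.
    apply: lower => // -[|l S] [_ SL]; first by rewrite big_nil.
    by exfalso; apply: nL; exists l; apply: SL; rewrite mem_head.
  rewrite pmulr_rle0// => h.
  have := le_trans (cabs2_samp_le 0 fk) h; rewrite -/(gam 0 0) gam_self.
  by rewrite -sqr_cabs cabs1 expr1n ler10.
(* The assumption d >= 1 supplies the coordinate, index 0, along which the weight grows. *)
exact: (sampling_interpolation_false A0 B0 bessel_L lower interp (Ordinal d1) Ll0).
Qed.
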